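(* Let $F:\mathbb R\to\mathbb R$ be a non-decreasing function with $F(\tau)=\frac12[F(\tau+0)+F(\tau-0)]$ for all $\tau\in\mathbb R$. Let $\rho:\mathbb R\to\mathbb R$ be a continuous function such that $|\rho(\tau)|\le \mathrm{const}\,(1+\tau^2)^{-m-1}$ for some $m>0$, $\int_{\mathbb R}\rho(\tau)\,d\tau=1$, $\rho$ is even, and $\rho\ge0$. Let $[a,b]$ be a bounded interval and $\delta>0$. Assume that for every $\tau\in[a,b]$ one has $\rho_{\delta,0}(\tau-s)\,F(s)\to0$ as $s\to\pm\infty$ and $\rho_{\delta,0}*F'(\tau)<\infty$, and that $\rho_{\delta,0}*F'(\tau)$ is uniformly bounded on $[a,b]$. Then for every non-negative non-decreasing function $f\in C^1[a,b]$ and all $T\ge\delta$, $$-\,T^{-1}\delta^{-1}f(b)\;\rho_{\delta,0}*F'(b)\ \le\ \int_a^b f(\tau)\left[F(\tau)-\rho_T*F(\tau)\right]d\tau$$ and $$\int_a^b f(\tau)\left[F(\tau)-\rho_T*F(\tau)\right]d\tau\ \le\ T^{-1}\delta^{-1}f(a)\;\rho_{\delta,0}*F'(a)+T^{-1}\delta^{-1}\int_a^b f'(\tau)\,\rho_{\delta,0}*F'(\tau)\,d\tau.$$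
   Context: Notation: $\rho_T(\tau):=T\rho(T\tau)$; $\rho_{\delta,0}(\tau):=\delta\,\rho_{1,0}(\delta\tau)$, where $\rho_{1,0}(\tau):=\int_\tau^\infty\mu\,\rho(\mu)\,d\mu$. For a piecewise continuous function $g$ on $\mathbb R$, $g*F(\tau):=\lim_{R\to\infty}\int_{-R}^R g(\tau-\mu)F(\mu)\,d\mu$ and $g*F'(\tau):=\lim_{R\to\infty}\int_{(-R,R)}g(\tau-\mu)\,dF(\mu)$ (Lebesgue–Stieltjes integral), whenever the limits exist. *)

(* Defs.v *)
From HB Require Import structures.
From mathcomp Require Import all_boot all_order all_algebra.
From mathcomp Require Import all_classical all_reals all_analysis.

Set Implicit Arguments.
Unset Strict Implicit.
Unset Printing Implicit Defensive.

Import Order.TTheory GRing.Theory Num.Theory.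
Import numFieldNormedType.Exports.

Local Open Scope classical_set_scope.
Local Open Scope ring_scope.

Section kernels.
Context {R : realType}.
Implicit Types (rho : R -> R) (t : R).

(* rho_T *)
Definition scaled_kernel (T : R) rho t : R := T * rho (T * t).

(* rho_{1,0} *)
Definition moment_kernel1 rho t : R :=
  \int[lebesgue_measure]_(mu in `[t, +oo[) (mu * rho mu).

(* rho_{delta,0} *)
Definition moment_kernel (delta : R) rho t : R :=
  delta * moment_kernel1 rho (delta * t).

End kernels.

(* The library builds Lebesgue-Stieltjes measures from right-continuous
   functions only, so dF is taken to be the measure of x |-> F(x + 0).  The
   proof that F is non-decreasing is an argument, to carry the [cumulative]
   structure. *)
Section right_limits.
Context {R : realType}.
Variables (F : R -> R) (F_nd : nondecreasing F).

Definition right_limit (_ : nondecreasing F) (x : R) : R := lim (F @ x^'+).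

Lemma is_cvg_right_limit (x : R) : cvg (F @ x^'+).
Proof.
apply: (@nondecreasing_at_right_is_cvgr _ F x).
  by near=> b => u v _ _ /F_nd.
near=> b; exists (F x) => _ [u /= + <-].
by rewrite in_itv/= => /andP[/ltW xu _]; exact: F_nd.
Unshelve. all: by end_near. Qed.

Lemma right_limit_ge (x : R) : F x <= right_limit F_nd x.
Proof.
apply: limr_ge; first exact: is_cvg_right_limit.
by near=> y; apply: F_nd; near: y; exact: nbhs_right_ge.
Unshelve. all: by end_near. Qed.

Lemma right_limit_le (x y : R) : x < y -> right_limit F_nd x <= F y.
Proof.
move=> xy; apply: limr_le; first exact: is_cvg_right_limit.
by near=> z; apply: F_nd; near: z; exact: nbhs_right_le.
Unshelve. all: by end_near. Qed.

Lemma right_limit_nondecreasing : nondecreasing (right_limit F_nd).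
Proof.
move=> x y; rewrite le_eqVlt => /predU1P[->//|xy].
exact: le_trans (right_limit_le xy) (right_limit_ge y).
Qed.

Lemma right_limit_right_continuous : right_continuous (right_limit F_nd).
Proof.
move=> x; apply/cvgrPdist_le => /= e e0.
have : F @ x^'+ --> right_limit F_nd x by exact: is_cvg_right_limit.
move=> /cvgrPdist_le/(_ _ e0)[d /= d0 dF].
near=> y.
have xy : x < y by near: y; exact: nbhs_right_gt.
have ydx : y < x + d / 2 by near: y; apply: nbhs_right_lt; rewrite ltrDl divr_gt0.
have dd : d / 2 < d by rewrite ltr_pdivrMr// ltr_pMr// ltr1n.
have xz : x < x + d / 2 by rewrite ltrDl divr_gt0.
have := dF (x + d / 2) => /= /(_ _ xz).
rewrite opprD addNKr normrN gtr0_norm ?divr_gt0// => /(_ dd).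
have h1 := right_limit_nondecreasing (ltW xy).
have h2 := right_limit_le ydx.
rewrite !ler0_norm ?subr_le0// ?(le_trans h1 h2)// !opprB.
by apply: le_trans; rewrite lerB.
Unshelve. all: by end_near. Qed.

HB.instance Definition _ := isCumulative.Build R _ R (right_limit F_nd)
  right_limit_nondecreasing right_limit_right_continuous.

End right_limits.

Section convolutions.
Context {R : realType}.

Definition convol_partial (g F : R -> R) (t r : R) : R :=
  \int[lebesgue_measure]_(mu in `[- r, r]) (g (t - mu) * F mu).

(* g * F; only meaningful when [cvg (convol_partial g F t r @[r --> +oo])]. *)
Definition convol (g F : R -> R) (t : R) : R :=
  lim (convol_partial g F t r @[r --> +oo]).

Definition convol_stieltjes_partial (g F : R -> R) (F_nd : nondecreasing F)
    (t r : R) : \bar R :=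
  (\int[lebesgue_stieltjes_measure (right_limit F_nd)]_(mu in `](- r)%R, r[)
     (g (t - mu))%:E)%E.

(* g * F'; for g >= 0 the limit always exists in [0, +oo]. *)
Definition convol_stieltjes (g F : R -> R) (F_nd : nondecreasing F) (t : R) :
    \bar R :=
  lim (convol_stieltjes_partial g F_nd t r @[r --> +oo]).

End convolutions.

(* f is in C^1[a, b] for a < b: the derivative on ]a, b[ extends continuously
   to [a, b]. The values [derive1 f a] and [derive1 f b], which depend on f
   outside [a, b], are left unconstrained. *)
Definition C1_itv {R : realType} (a b : R) (f : R -> R) : Prop :=
  derivable_oo_LRcontinuous f a b /\
  exists2 g : R -> R,
    {within `[a, b], continuous g} & {in `]a, b[, derive1 f =1 g}.

(* Main.v *)
(* Write [w] for the restriction of [rho_T] to the positive half-line.  Since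
   [rho] is even with integral 1, [F t - rho_T * F t = L t - N t] where
   [L t = \int w v (F t - F (t - v)) dv] and
   [N t = \int w v (F (t + v) - F t) dv] are nonnegative.  For fixed [v], with
   [f] extended by 0 outside [a, b], translation gives
   [\int f t (F t - F (t - v)) dt = \int f (t + v) (F (t + v) - F t) dt], and
   [f t] and [f (t + v)] differ only by the part of [f'] in [t, t + v] and by
   the jumps at [a] and [b].  This compares [\int f L] with [\int f N] up to the
   moments [\int v w v (F (t + v) - F (t - v)) dv]; as
   [F (t + v) - F (t - v) <= dF [t - v, t + v]], Tonelli bounds such a moment by
   [T^-1 delta^-1 rho_{delta,0} * F' t].  The same moment controls the tails in
   [L] and [N], which yields the convergence of [rho_T * F]. *)
Require Import Defs.
From HB Require Import structures.
From mathcomp Require Import all_boot all_order all_algebra.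
From mathcomp Require Import all_classical all_reals all_analysis.
From mathcomp Require Import measurable_realfun.
From mathcomp Require Import ring lra.

Set Implicit Arguments.
Unset Strict Implicit.
Unset Printing Implicit Defensive.

Import Order.TTheory GRing.Theory Num.Theory.
Import numFieldNormedType.Exports.

Local Open Scope classical_set_scope.
Local Open Scope ring_scope.

(** The difference [F t - rho_T * F t] has no sign and its convergence is not given, so the
    comparison is made between integrals of nonnegative functions in the extended reals, where
    Tonelli asks for no integrability. The two sides are subtracted only once both are finite, which
    the uniform bound on [rho_{delta,0} * F'] ensures. The two inequalities differ in shape because
    [f] is non-decreasing: extended by 0, [f t <= f (t + v)] fails at most when [t + v] has passed
    [b], at cost [f b], whereas [f (t + v) <= f t] fails through the jump up at [a], at cost [f a],
    and through the growth of [f], at cost [f']. A defect located at [u] is felt exactly for [t] in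
    [[u - v, u]]. This window has length [v], which is the origin of the factor [v] in the
    moments. *)

Section change_of_variables.
Context {R : realType}.
Local Open Scope ereal_scope.
Local Notation mu := (@lebesgue_measure R).

(** * Translation, dilation and reflection in Lebesgue integrals of nonnegative functions *)

Lemma ge0_integral_shift (c : R) (f : R -> \bar R) :
  measurable_fun [set: R] f -> (forall x, 0 <= f x) ->
  \int[mu]_x f (x + c)%R = \int[mu]_x f x.
Proof.
move=> mf f0.
have mphi : measurable_fun [set: measurableTypeR R]
    ((fun x : R => x + c)%R : _ -> measurableTypeR R).
  exact: measurable_funD.
have := ge0_integral_pushforward mphi mu (D := setT) (f := f) measurableT mf.
rewrite preimage_setT /comp => <-; last by move=> y _; exact: f0.
apply: eq_measure_integral => //= A mA _.
(* The image of Lebesgue measure under the translation gives every half-open interval its length,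
   and this determines the measure. *)
apply/esym/lebesgue_measure_unique => //= _ [[a b]] _ <-.
rewrite /pushforward/=.
rewrite (_ : (fun x : R => x + c)%R @^-1` _ = `](a - c)%R, (b - c)%R]%classic).
  rewrite !lebesgue_measure_itv/= !lte_fin ltrD2r.
  by case: ifPn => // _; rewrite -!EFinD; congr (_%:E); ring.
by apply/seteqP; split => x /=; rewrite !in_itv/= ltrBlDr lerBrDr.
Qed.

Lemma ge0_integral_scale (c : R) (f : R -> \bar R) : (0 < c)%R ->
  measurable_fun [set: R] f -> (forall x, 0 <= f x) ->
  \int[mu]_x f x = c%:E * \int[mu]_x f (c * x)%R.
Proof.
move=> c0 mf f0.
pose phi : measurableTypeR R -> measurableTypeR R := fun x => (c * x)%R.
have mphi : measurable_fun setT phi by exact: measurable_funM.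
have := ge0_integral_pushforward mphi mu (D := setT) (f := f) measurableT mf.
rewrite preimage_setT /comp => <-; last by move=> y _; exact: f0.
have ci0 : (0 <= c^-1)%R by rewrite invr_ge0 ltW.
transitivity (c%:E * \int[mscale (NngNum ci0) mu]_x f x).
  by rewrite ge0_integral_mscale//= muleA -EFinM divff ?gt_eqF// mul1e.
congr (_ * _); apply: eq_measure_integral => //= A mA _.
pose nu := measure_function_pushforward__canonical__measure_function_Measure mu mphi.
(* Uniqueness is applied to [c] times the image measure, since that is the multiple giving intervals
   their length. *)
suff muA : mu A = mscale (NngNum (ltW c0)) nu A.
  by rewrite /mscale/= [X in _ * X = _]muA /mscale/= muleA -EFinM mulVf ?gt_eqF// mul1e.
apply: lebesgue_measure_unique => //= _ [[a b]] _ <-.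
rewrite /mscale/= /pushforward/= /phi.
rewrite (_ : (fun x : R => c * x)%R @^-1` _ = `](a / c)%R, (b / c)%R]%classic).
  rewrite !lebesgue_measure_itv/= !lte_fin ltr_pM2r ?invr_gt0//.
  case: ifPn => // _; rewrite ?mule0// -!EFinD -EFinM; congr (_%:E).
  by field; rewrite gt_eqF.
by apply/seteqP; split => x /=; rewrite !in_itv/= ltr_pdivrMr// ler_pdivlMr// mulrC.
Qed.

Lemma ge0_integral_reflect (c : R) (f : R -> \bar R) :
  measurable_fun [set: R] f -> (forall x, 0 <= f x) ->
  \int[mu]_x f (c - x)%R = \int[mu]_x f x.
Proof.
move=> mf f0.
have mfN : measurable_fun [set: R] (fun x : R => f (- x)%R).
  by apply: measurableT_comp => //; exact: oppr_measurable.
transitivity (\int[mu]_x f (- (x + - c))%R).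
  by apply: eq_integral => x _; congr f; ring.
rewrite (@ge0_integral_shift (- c)%R (fun x => f (- x)%R))//.
have mphi : measurable_fun [set: measurableTypeR R]
    (-%R : _ -> measurableTypeR R).
  exact: oppr_measurable.
have := ge0_integral_pushforward mphi mu (D := setT) (f := f) measurableT mf.
rewrite preimage_setT /comp => <-; last by move=> y _; exact: f0.
by apply: eq_measure_integral => //= A mA _; exact: lebesgue_measureN.
Qed.

End change_of_variables.

(** * Exchange of integrals for nonnegative real kernels in curried form *)

Section tonelli.
Context {R : realType} d1 d2 (T1 : measurableType d1) (T2 : measurableType d2)
  (m1 : {sigma_finite_measure set T1 -> \bar R})
  (m2 : {sigma_finite_measure set T2 -> \bar R}).
Local Open Scope ereal_scope.

Lemma tonelli_EFin (h : T1 -> T2 -> R) :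
  measurable_fun setT (fun z : T1 * T2 => h z.1 z.2) ->
  (forall x y, 0 <= h x y)%R ->
  \int[m1]_x \int[m2]_y (h x y)%:E = \int[m2]_y \int[m1]_x (h x y)%:E.
Proof.
move=> mh h0.
apply: (fubini_tonelli (m1 := m1) (m2 := m2) (fun z => (h z.1 z.2)%:E)).
- exact/measurable_EFinP.
- by move=> x; rewrite lee_fin.
Qed.

Lemma measurable_integral_EFin (h : T1 -> T2 -> R) :
  measurable_fun setT (fun z : T1 * T2 => h z.1 z.2) ->
  (forall x y, 0 <= h x y)%R ->
  measurable_fun setT (fun x => \int[m2]_y (h x y)%:E).
Proof.
move=> mh h0.
apply: (measurable_fun_fubini_tonelli_F (m2 := m2) (fun z => (h z.1 z.2)%:E)).
- exact/measurable_EFinP.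
- by move=> x; rewrite lee_fin.
Qed.

End tonelli.

(** * Comparison of left and right increments of a non-decreasing function *)

Section increments.
Context {R : realType}.
Local Open Scope ereal_scope.
Local Notation mu := (@lebesgue_measure R).
Variables (F : R -> R) (F_nd : nondecreasing F).

Let mF : measurable_fun [set: R] F.
Proof. exact: nondecreasing_measurable. Qed.

(** On the window, [t + v <= u + v] and [u - v <= t], so the integrand is at most
    [F (u + v) - F (u - v)]; the window has length [v]. *)
Lemma window_increment_le (u v : R) : (0 <= v)%R ->
  \int[mu]_t (if (u - v <= t <= u)%R then F (t + v) - F t else 0)%:E <=
  (v * (F (u + v) - F (u - v)))%:E.
Proof.
move=> v0; pose c := (F (u + v) - F (u - v))%R.
have c0 : (0 <= c)%R by rewrite subr_ge0; apply: F_nd; lra.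
apply: (@le_trans _ _ (\int[mu]_(t in `[(u - v)%R, u]) c%:E)).
  rewrite [leRHS]integral_mkcond; apply: ge0_le_integral => //=.
  - move=> t _; rewrite lee_fin; case: ifP => // _.
    by rewrite subr_ge0; apply: F_nd; rewrite lerDl.
  - apply/measurable_EFinP; apply: measurable_fun_ifT => //=.
    + by apply: measurable_and; exact: measurable_fun_ler.
    + apply: measurable_funB => //; apply: measurableT_comp => //.
      exact: measurable_funD.
  - by apply/(measurable_restrictT (cst c%:E)).
  - move=> t _; rewrite patchE /= mem_setE in_itv/=.
    case: ifPn => // /andP[ut tu]; rewrite lee_fin.
    by apply: lerB; apply: F_nd; lra.
rewrite integral_cst//= lebesgue_measure_itv/= lte_fin.
case: ifPn => [_|]; first by rewrite -EFinB -EFinM lee_fin /c; nra.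
by move=> _; rewrite mule0 lee_fin mulr_ge0.
Qed.


Lemma measurable_increment (v : R) :
  measurable_fun [set: R] (fun t : R => F (t + v) - F t)%R.
Proof.
by apply: measurable_funB => //; apply: measurableT_comp => //; exact: measurable_funD.
Qed.

Lemma measurable_increment2 (v : R) :
  measurable_fun [set: R] (fun t : R => F (t + v) - F (t - v))%R.
Proof.
by apply: measurable_funB; apply: measurableT_comp => //; exact: measurable_funD.
Qed.

Lemma increment_ge0 (t v : R) : (0 <= v)%R -> (0 <= F (t + v) - F t)%R.
Proof. by move=> v0; rewrite subr_ge0; apply: F_nd; rewrite lerDl. Qed.

Lemma left_increment_shift (phi : R -> R) (v : R) : (0 <= v)%R ->
  measurable_fun [set: R] phi -> (forall t, 0 <= phi t)%R ->
  \int[mu]_t (phi t * (F t - F (t - v)))%:E =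
  \int[mu]_t (phi (t + v) * (F (t + v) - F t))%:E.
Proof.
move=> v0 mphi phi0.
rewrite -(@ge0_integral_shift _ v).
- by apply: eq_integral => t _; rewrite addrK.
- apply/measurable_EFinP; apply: measurable_funM => //; apply: measurable_funB => //.
  by apply: measurableT_comp => //; exact: measurable_funB.
- move=> t; rewrite lee_fin mulr_ge0// subr_ge0; apply: F_nd.
  by rewrite lerBlDr lerDl.
Qed.

Lemma measurable_window (c v x : R) :
  measurable_fun [set: R] (fun t : R => if (c - v <= t <= c)%R then x else 0%R).
Proof.
apply: measurable_fun_ifT => //=.
by apply: measurable_and; exact: measurable_fun_ler.
Qed.

(** After translation the weight is [phi (t + v)], and the hypothesis trades it for [phi t] plus two
    defects: an upward jump [A] at [a], and growth of density [d]. Each defect is carried by windows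
    [[u - v, u]], over which the increment of [F] is controlled by [window_increment_le]. *)
Lemma weighted_increment_ub (phi d : R -> R) (A a v : R) : (0 <= v)%R ->
  measurable_fun [set: R] phi -> (forall t, 0 <= phi t)%R ->
  measurable_fun [set: R] d -> (forall t, 0 <= d t)%R -> (0 <= A)%R ->
  (forall t, (phi (t + v))%:E <= (phi t)%:E +
    ((if (a - v <= t <= a)%R then A else 0)%:E +
     \int[mu]_u (if (u - v <= t <= u)%R then d u else 0)%:E)) ->
  \int[mu]_t (phi t * (F t - F (t - v)))%:E <=
  \int[mu]_t (phi t * (F (t + v) - F t))%:E +
    ((A * (v * (F (a + v) - F (a - v))))%:E +
     \int[mu]_u (d u * (v * (F (u + v) - F (u - v))))%:E).
Proof.
move=> v0 mphi phi0 md d0 A0 phi_ub.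
rewrite left_increment_shift//.
pose X t := (F (t + v) - F t)%R.
have X0 t : (0 <= X t)%R by exact: increment_ge0.
have mX : measurable_fun [set: R] X by exact: measurable_increment.
pose h (t u : R) := (X t * (if (u - v <= t <= u)%R then d u else 0))%R.
have h0 t u : (0 <= h t u)%R by rewrite mulr_ge0//; case: ifP.
have mh : measurable_fun [set: R * R] (fun z : R * R => h z.1 z.2).
  apply: measurable_funM; first exact: measurableT_comp.
  apply: measurable_fun_ifT => //=; last exact: measurableT_comp.
  by apply: measurable_and; apply: measurable_fun_ler => //; exact: measurable_funB.
have mhF : measurable_fun [set: R] (fun t => \int[mu]_u (h t u)%:E).
  exact: measurable_integral_EFin.
have mXA : measurable_fun [set: R]
    (fun t : R => X t * (if (a - v <= t <= a)%R then A else 0))%R.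
  by apply: measurable_funM => //; exact: measurable_window.
apply: (@le_trans _ _ (\int[mu]_t ((phi t * X t)%:E +
    ((X t * (if (a - v <= t <= a)%R then A else 0))%:E +
     \int[mu]_u (h t u)%:E)))).
  apply: ge0_le_integral => //=.
  - by move=> t _; rewrite lee_fin mulr_ge0// X0.
  - apply/measurable_EFinP; apply: measurable_funM => //.
    by apply: measurableT_comp => //; exact: measurable_funD.
  - apply: emeasurable_funD; first by apply/measurable_EFinP; exact: measurable_funM.
    apply: emeasurable_funD => //; exact/measurable_EFinP.
  - move=> t _; rewrite mulrC EFinM.
    apply: le_trans (lee_wpmul2l _ (phi_ub t)) _; first by rewrite lee_fin X0.
    have i0 : 0 <= \int[mu]_u (if (u - v <= t <= u)%R then d u else 0)%:E.
      by apply: integral_ge0 => u _; rewrite lee_fin; case: ifP.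
    rewrite ge0_muleDr//; last 2 first.
      by rewrite lee_fin.
      by rewrite adde_ge0// lee_fin; case: ifP.
    rewrite ge0_muleDr//; last by rewrite lee_fin; case: ifP.
    rewrite -!EFinM (mulrC (phi t)) -ge0_integralZl_EFin//.
    + by move=> u _; rewrite lee_fin; case: ifP.
    + apply/measurable_EFinP; apply: measurable_fun_ifT => //=.
      by apply: measurable_and; apply: measurable_fun_ler => //; exact: measurable_funB.
    + exact: X0.
rewrite ge0_integralD//=; last 4 first.
- by move=> t _; rewrite lee_fin mulr_ge0.
- by apply/measurable_EFinP; exact: measurable_funM.
- move=> t _; rewrite adde_ge0//; last by apply: integral_ge0 => u _; rewrite lee_fin.
  by rewrite lee_fin mulr_ge0//; case: ifP.
- by apply: emeasurable_funD => //; exact/measurable_EFinP.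
rewrite leeD2l// ge0_integralD//=; last 3 first.
- by move=> t _; rewrite lee_fin mulr_ge0//; case: ifP.
- exact/measurable_EFinP.
- by move=> t _; apply: integral_ge0 => u _; rewrite lee_fin.
(* Used twice: at [u = a] with height [A], and at each [u] of the outer integral with height
   [d u]. *)
have window (u : R) (y : R) : (0 <= y)%R ->
  \int[mu]_t (X t * (if (u - v <= t <= u)%R then y else 0))%:E <=
  (y * (v * (F (u + v) - F (u - v))))%:E.
  move=> y0; rewrite EFinM.
  have yE : 0 <= y%:E by rewrite lee_fin.
  apply: (le_trans _ (lee_wpmul2l yE (window_increment_le u v0))).
  rewrite -ge0_integralZl_EFin//; last 2 first.
  - by move=> t _; rewrite lee_fin; case: ifP => // _; exact: X0.
  - apply/measurable_EFinP; apply: measurable_fun_ifT => //=.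
    by apply: measurable_and; exact: measurable_fun_ler.
  rewrite le_eqVlt; apply/orP; left; apply/eqP; apply: eq_integral => t _.
  by case: ifP => _; rewrite -EFinM ?mulr0// mulrC.
apply: leeD; first exact: window.
(* With [u] outermost, the integral in [t] is a single window of constant height [d u]. *)
rewrite tonelli_EFin//; apply: ge0_le_integral => //=.
- by move=> u _; apply: integral_ge0 => t _; rewrite lee_fin.
- apply: (@measurable_integral_EFin _ _ _ _ _ mu (fun u t : R => h t u)) => //.
  apply: (measurableT_comp (f := fun z : R * R => h z.1 z.2)
    (g := fun z : R * R => (z.2, z.1))) => //=.
  exact: measurable_fun_pair.
- apply/measurable_EFinP; apply: measurable_funM => //; apply: measurable_funM => //.
  exact: measurable_increment2.
- by move=> u _; exact: window.
Qed.

(** The same translation read in the opposite direction: replacing [phi t] by [phi (t + v)] costs a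
    single window at [b], of height [B]. *)
Lemma weighted_increment_lb (phi : R -> R) (B b v : R) : (0 <= v)%R ->
  measurable_fun [set: R] phi -> (forall t, 0 <= phi t)%R -> (0 <= B)%R ->
  (forall t, phi t <= phi (t + v) + (if (b - v <= t <= b)%R then B else 0))%R ->
  \int[mu]_t (phi t * (F (t + v) - F t))%:E <=
  \int[mu]_t (phi t * (F t - F (t - v)))%:E +
    (B * (v * (F (b + v) - F (b - v))))%:E.
Proof.
move=> v0 mphi phi0 B0 phi_ub.
rewrite left_increment_shift//.
pose X t := (F (t + v) - F t)%R.
have X0 t : (0 <= X t)%R by exact: increment_ge0.
have mX : measurable_fun [set: R] X by exact: measurable_increment.
have mphiv : measurable_fun [set: R] (fun t => phi (t + v) * X t)%R.
  apply: measurable_funM => //.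
  by apply: measurableT_comp => //; exact: measurable_funD.
have mW : measurable_fun [set: R] (fun t => if (b - v <= t <= b)%R then X t else 0%R).
  apply: measurable_fun_ifT => //=.
  by apply: measurable_and; exact: measurable_fun_ler.
apply: (@le_trans _ _ (\int[mu]_t ((phi (t + v) * X t)%:E +
    (B * (if (b - v <= t <= b)%R then X t else 0))%:E))).
  apply: ge0_le_integral => //=.
  - by move=> t _; rewrite lee_fin mulr_ge0// X0.
  - by apply/measurable_EFinP; exact: measurable_funM.
  - apply: emeasurable_funD; first exact/measurable_EFinP.
    by apply/measurable_EFinP; exact: measurable_funM.
  - move=> t _; rewrite -EFinD lee_fin.
    apply: le_trans (ler_wpM2r (X0 t) (phi_ub t)) _.
    by rewrite mulrDl lerD2l; case: ifP; rewrite ?mul0r ?mulr0.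
rewrite ge0_integralD//=; last 4 first.
- by move=> t _; rewrite lee_fin mulr_ge0.
- exact/measurable_EFinP.
- by move=> t _; rewrite lee_fin mulr_ge0//; case: ifP.
- by apply/measurable_EFinP; exact: measurable_funM.
rewrite leeD2l// EFinM.
have BE : 0 <= B%:E by rewrite lee_fin.
apply: (le_trans _ (lee_wpmul2l BE (window_increment_le b v0))).
rewrite -ge0_integralZl_EFin//.
- by move=> t _; rewrite lee_fin; case: ifP => // _; exact: X0.
- exact/measurable_EFinP.
Qed.

(** * Increments averaged against a weight carried by the positive half-line *)

Section weighted.
Variables (w : R -> R) (mw : measurable_fun [set: R] w).
Hypotheses (w_ge0 : forall v, (0 <= w v)%R) (w0 : forall v, (v <= 0)%R -> w v = 0%R).

Definition left_increment (t : R) := \int[mu]_v (w v * (F t - F (t - v)))%:E.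
Definition right_increment (t : R) := \int[mu]_v (w v * (F (t + v) - F t))%:E.
Definition moment_increment (t : R) :=
  \int[mu]_v (w v * (v * (F (t + v) - F (t - v))))%:E.

Lemma weight_mul_ge0 (v y : R) : ((0 <= v)%R -> (0 <= y)%R) -> (0 <= w v * y)%R.
Proof.
have [v0|/ltW v0 /(_ v0) y0] := leP v 0%R; last by rewrite mulr_ge0.
by rewrite w0 ?mul0r.
Qed.

Lemma left_weight_ge0 t v : (0 <= w v * (F t - F (t - v)))%R.
Proof.
apply: weight_mul_ge0 => v0; rewrite subr_ge0; apply: F_nd.
by rewrite lerBlDr lerDl.
Qed.

Lemma right_weight_ge0 t v : (0 <= w v * (F (t + v) - F t))%R.
Proof. by apply: weight_mul_ge0 => v0; exact: increment_ge0. Qed.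

Lemma moment_weight_ge0 t v : (0 <= w v * (v * (F (t + v) - F (t - v))))%R.
Proof.
apply: weight_mul_ge0 => v0; rewrite mulr_ge0// subr_ge0; apply: F_nd.
by rewrite lerD2l; lra.
Qed.

Lemma left_increment_ge0 t : 0 <= left_increment t.
Proof. by apply: integral_ge0 => v _; rewrite lee_fin left_weight_ge0. Qed.

Lemma right_increment_ge0 t : 0 <= right_increment t.
Proof. by apply: integral_ge0 => v _; rewrite lee_fin right_weight_ge0. Qed.

Lemma moment_increment_ge0 t : 0 <= moment_increment t.
Proof. by apply: integral_ge0 => v _; rewrite lee_fin moment_weight_ge0. Qed.

Lemma measurable_left_weight :
  measurable_fun [set: R * R] (fun z : R * R => w z.2 * (F z.1 - F (z.1 - z.2)))%R.
Proof.
apply: measurable_funM; first exact: measurableT_comp.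
by apply: measurable_funB; apply: (measurableT_comp mF) => //; exact: measurable_funB.
Qed.

Lemma measurable_right_weight :
  measurable_fun [set: R * R] (fun z : R * R => w z.2 * (F (z.1 + z.2) - F z.1))%R.
Proof.
apply: measurable_funM; first exact: measurableT_comp.
by apply: measurable_funB; apply: (measurableT_comp mF) => //; exact: measurable_funD.
Qed.

Lemma measurable_moment_weight :
  measurable_fun [set: R * R]
    (fun z : R * R => w z.2 * (z.2 * (F (z.1 + z.2) - F (z.1 - z.2))))%R.
Proof.
apply: measurable_funM; first exact: measurableT_comp.
apply: measurable_funM => //.
by apply: measurable_funB; apply: (measurableT_comp mF);
  [exact: measurable_funD|exact: measurable_funB].
Qed.

(** A common form for the left, right and moment increments. Those increments may be negative at
    [v < 0], where [w] vanishes, so nonnegativity is asked of the product [w v * h t v]. *)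
Lemma integral_weight_comm (phi : R -> R) (h : R -> R -> R) :
  measurable_fun [set: R] phi -> (forall t, 0 <= phi t)%R ->
  measurable_fun [set: R * R] (fun z : R * R => w z.2 * h z.1 z.2)%R ->
  (forall t v, 0 <= w v * h t v)%R ->
  \int[mu]_t ((phi t)%:E * \int[mu]_v (w v * h t v)%:E) =
  \int[mu]_v \int[mu]_t (w v * (phi t * h t v))%:E.
Proof.
move=> mphi phi0 mh h0.
transitivity (\int[mu]_t \int[mu]_v (phi t * (w v * h t v))%:E).
  apply: eq_integral => t _.
  rewrite -ge0_integralZl_EFin//; first by move=> v _; rewrite lee_fin.
  apply/measurable_EFinP.
  apply: (measurableT_comp (f := fun z : R * R => (w z.2 * h z.1 z.2)%R)
    (g := fun v : R => (t, v))) => //.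
  exact: measurable_fun_pair.
apply: (etrans (@tonelli_EFin _ _ _ _ _ mu mu
  (fun t v : R => phi t * (w v * h t v))%R _ _)).
- by apply: measurable_funM => //; exact: measurableT_comp.
- by move=> t v; exact: mulr_ge0.
- by apply: eq_integral => v _; apply: eq_integral => t _; congr EFin; ring.
Qed.

Lemma measurable_integral_weight (phi : R -> R) (h : R -> R -> R) :
  measurable_fun [set: R] phi -> (forall t, 0 <= phi t)%R ->
  measurable_fun [set: R * R] (fun z : R * R => w z.2 * h z.1 z.2)%R ->
  (forall t v, 0 <= w v * h t v)%R ->
  measurable_fun [set: R] (fun v => \int[mu]_t (w v * (phi t * h t v))%:E).
Proof.
move=> mphi phi0 mh h0.
apply: (@measurable_integral_EFin _ _ _ _ _ mu
  (fun v t : R => w v * (phi t * h t v))%R) => //=.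
- rewrite (_ : (fun _ => _) =
      (fun z : R * R => phi z.2 * (w z.1 * h z.2 z.1))%R); last first.
    by apply/funext => z; ring.
  apply: measurable_funM; first exact: measurableT_comp.
  apply: (measurableT_comp (f := fun z : R * R => (w z.2 * h z.1 z.2)%R)
    (g := fun z : R * R => (z.2, z.1))) => //=.
  exact: measurable_fun_pair.
- by move=> v t; rewrite mulrCA mulr_ge0.
Qed.

(** Tonelli makes [v] the outer variable on both sides, which reduces the claim to
    [weighted_increment_ub] for one shift at a time. *)
Lemma left_increment_ub (phi d : R -> R) (A a : R) :
  measurable_fun [set: R] phi -> (forall t, 0 <= phi t)%R ->
  measurable_fun [set: R] d -> (forall t, 0 <= d t)%R -> (0 <= A)%R ->
  (forall t v, (0 <= v)%R -> (phi (t + v))%:E <= (phi t)%:E +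
    ((if (a - v <= t <= a)%R then A else 0)%:E +
     \int[mu]_u (if (u - v <= t <= u)%R then d u else 0)%:E)) ->
  \int[mu]_t ((phi t)%:E * left_increment t) <=
  \int[mu]_t ((phi t)%:E * right_increment t) +
    (A%:E * moment_increment a + \int[mu]_u ((d u)%:E * moment_increment u)).
Proof.
move=> mphi phi0 md d0 A0 phi_ub.
rewrite !integral_weight_comm//; [|exact: measurable_moment_weight
  |exact: moment_weight_ge0|exact: measurable_right_weight
  |exact: right_weight_ge0|exact: measurable_left_weight|exact: left_weight_ge0].
rewrite -ge0_integralZl_EFin//; last 2 first.
  by move=> v _; rewrite lee_fin moment_weight_ge0.
  apply/measurable_EFinP.
  apply: (measurableT_comp measurable_moment_weight (g := fun v : R => (a, v))).
  exact: measurable_fun_pair.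
have m1 : measurable_fun [set: R]
    (fun v => \int[mu]_t (w v * (phi t * (F (t + v) - F t)))%:E).
  by apply: measurable_integral_weight => //;
    [exact: measurable_right_weight|exact: right_weight_ge0].
have m2 : measurable_fun [set: R]
    (fun v => \int[mu]_u (w v * (d u * (v * (F (u + v) - F (u - v)))))%:E).
  by apply: measurable_integral_weight => //;
    [exact: measurable_moment_weight|exact: moment_weight_ge0].
have m3 : measurable_fun [set: R]
    (fun v => A%:E * (w v * (v * (F (a + v) - F (a - v))))%:E).
  apply: emeasurable_funM => //; apply/measurable_EFinP.
  apply: (measurableT_comp measurable_moment_weight (g := fun v : R => (a, v))).
  exact: measurable_fun_pair.
have p1 v : 0 <= \int[mu]_t (w v * (phi t * (F (t + v) - F t)))%:E.
  by apply: integral_ge0 => t _; rewrite lee_fin mulrCA mulr_ge0 ?right_weight_ge0.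
have p2 v : 0 <= \int[mu]_u (w v * (d u * (v * (F (u + v) - F (u - v)))))%:E.
  by apply: integral_ge0 => t _; rewrite lee_fin mulrCA mulr_ge0 ?moment_weight_ge0.
have p3 v : 0 <= A%:E * (w v * (v * (F (a + v) - F (a - v))))%:E.
  by rewrite mule_ge0 ?lee_fin ?moment_weight_ge0.
rewrite -ge0_integralD// -ge0_integralD//; last 2 first.
  by move=> v _; rewrite adde_ge0.
  exact: emeasurable_funD.
apply: ge0_le_integral => //=.
- move=> v _; apply: integral_ge0 => t _.
  by rewrite lee_fin mulrCA mulr_ge0 ?left_weight_ge0.
- by apply: measurable_integral_weight => //;
    [exact: measurable_left_weight|exact: left_weight_ge0].
- by apply: emeasurable_funD => //; exact: emeasurable_funD.
(* The fixed-shift estimate is meant for [v >= 0]; for the other [v] the weight, hence the left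
   side, is 0. *)
- move=> v _; have [v0|/ltW v0] := leP v 0%R.
    rewrite integral0_eq; last by move=> t _; rewrite w0 ?mul0r.
    exact: adde_ge0 (p1 v) (adde_ge0 (p3 v) (p2 v)).
  have g1 t : (0 <= F t - F (t - v))%R.
    by rewrite subr_ge0; apply: F_nd; rewrite lerBlDr lerDl.
  have g2 t : (0 <= F (t + v) - F t)%R by exact: increment_ge0.
  have g3 t : (0 <= v * (F (t + v) - F (t - v)))%R.
    by rewrite mulr_ge0// subr_ge0; apply: F_nd; rewrite lerD2l; lra.
  have mm : measurable_fun [set: R] (fun t => F t - F (t - v))%R.
    by apply: measurable_funB => //; apply: (measurableT_comp mF); exact: measurable_funB.
  have -> : A%:E * (w v * (v * (F (a + v) - F (a - v))))%:E =
      (w v)%:E * (A * (v * (F (a + v) - F (a - v))))%:E.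
    by rewrite -!EFinM mulrCA.
  under eq_integral do rewrite EFinM.
  under [X in _ <= X + _]eq_integral do rewrite EFinM.
  under [X in _ <= _ + (_ + X)]eq_integral do rewrite EFinM.
  rewrite !ge0_integralZl_EFin//; last 6 first.
  + by move=> t _; rewrite lee_fin mulr_ge0.
  + apply/measurable_EFinP; apply: measurable_funM => //; apply: measurable_funM => //.
    exact: measurable_increment2.
  + by move=> t _; rewrite lee_fin mulr_ge0.
  + by apply/measurable_EFinP; apply: measurable_funM => //; exact: measurable_increment.
  + by move=> t _; rewrite lee_fin mulr_ge0.
  + by apply/measurable_EFinP; exact: measurable_funM.
  have q1 : 0 <= \int[mu]_t (phi t * (F (t + v) - F t))%:E.
    by apply: integral_ge0 => t _; rewrite lee_fin mulr_ge0.
  have q2 : 0 <= (A * (v * (F (a + v) - F (a - v))))%:E by rewrite lee_fin mulr_ge0.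
  have q3 : 0 <= \int[mu]_u (d u * (v * (F (u + v) - F (u - v))))%:E.
    by apply: integral_ge0 => t _; rewrite lee_fin mulr_ge0.
  rewrite -(ge0_muleDr _ q2 q3) -(ge0_muleDr _ q1 (adde_ge0 q2 q3)).
  apply: lee_wpmul2l; first by rewrite lee_fin.
  by apply: weighted_increment_ub => // t; exact: phi_ub.
Qed.

(** The counterpart of [left_increment_ub], by the same exchange and [weighted_increment_lb]. *)
Lemma right_increment_ub (phi : R -> R) (B b : R) :
  measurable_fun [set: R] phi -> (forall t, 0 <= phi t)%R -> (0 <= B)%R ->
  (forall t v, 0 <= v ->
    phi t <= phi (t + v) + (if (b - v <= t <= b)%R then B else 0))%R ->
  \int[mu]_t ((phi t)%:E * right_increment t) <=
  \int[mu]_t ((phi t)%:E * left_increment t) + B%:E * moment_increment b.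
Proof.
move=> mphi phi0 B0 phi_ub.
rewrite !integral_weight_comm//; [|exact: measurable_left_weight|exact: left_weight_ge0
  |exact: measurable_right_weight |exact: right_weight_ge0].
rewrite -ge0_integralZl_EFin//; last 2 first.
  by move=> v _; rewrite lee_fin moment_weight_ge0.
  apply/measurable_EFinP.
  apply: (measurableT_comp measurable_moment_weight (g := fun v : R => (b, v))).
  exact: measurable_fun_pair.
have m1 : measurable_fun [set: R]
    (fun v => \int[mu]_t (w v * (phi t * (F t - F (t - v))))%:E).
  by apply: measurable_integral_weight => //;
    [exact: measurable_left_weight|exact: left_weight_ge0].
have m3 : measurable_fun [set: R]
    (fun v => B%:E * (w v * (v * (F (b + v) - F (b - v))))%:E).
  apply: emeasurable_funM => //; apply/measurable_EFinP.
  apply: (measurableT_comp measurable_moment_weight (g := fun v : R => (b, v))).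
  exact: measurable_fun_pair.
have p1 v : 0 <= \int[mu]_t (w v * (phi t * (F t - F (t - v))))%:E.
  by apply: integral_ge0 => t _; rewrite lee_fin mulrCA mulr_ge0 ?left_weight_ge0.
have p3 v : 0 <= B%:E * (w v * (v * (F (b + v) - F (b - v))))%:E.
  by rewrite mule_ge0 ?lee_fin ?moment_weight_ge0.
rewrite -ge0_integralD//.
apply: ge0_le_integral => //=.
- move=> v _; apply: integral_ge0 => t _.
  by rewrite lee_fin mulrCA mulr_ge0 ?right_weight_ge0.
- by apply: measurable_integral_weight => //;
    [exact: measurable_right_weight|exact: right_weight_ge0].
- exact: emeasurable_funD.
- move=> v _; have [v0|/ltW v0] := leP v 0%R.
    rewrite integral0_eq; last by move=> t _; rewrite w0 ?mul0r.
    exact: adde_ge0 (p1 v) (p3 v).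
  have g1 t : (0 <= F t - F (t - v))%R.
    by rewrite subr_ge0; apply: F_nd; rewrite lerBlDr lerDl.
  have g2 t : (0 <= F (t + v) - F t)%R by exact: increment_ge0.
  have mm : measurable_fun [set: R] (fun t => F t - F (t - v))%R.
    by apply: measurable_funB => //; apply: (measurableT_comp mF); exact: measurable_funB.
  have -> : B%:E * (w v * (v * (F (b + v) - F (b - v))))%:E =
      (w v)%:E * (B * (v * (F (b + v) - F (b - v))))%:E.
    by rewrite -!EFinM mulrCA.
  under eq_integral do rewrite EFinM.
  under [X in _ <= X + _]eq_integral do rewrite EFinM.
  rewrite !ge0_integralZl_EFin//; last 4 first.
  + by move=> t _; rewrite lee_fin mulr_ge0.
  + by apply/measurable_EFinP; apply: measurable_funM.
  + by move=> t _; rewrite lee_fin mulr_ge0.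
  + by apply/measurable_EFinP; apply: measurable_funM => //; exact: measurable_increment.
  have q1 : 0 <= \int[mu]_t (phi t * (F t - F (t - v)))%:E.
    by apply: integral_ge0 => t _; rewrite lee_fin mulr_ge0.
  have q2 : 0 <= (B * (v * (F (b + v) - F (b - v))))%:E.
    by rewrite lee_fin !mulr_ge0// subr_ge0; apply: F_nd; rewrite lerD2l; lra.
  rewrite -(ge0_muleDr _ q1 q2).
  apply: lee_wpmul2l; first by rewrite lee_fin.
  by apply: weighted_increment_lb => // t; exact: phi_ub.
Qed.

End weighted.
End increments.

(** * A non-decreasing [C^1] function extended by zero, and its defect under translation *)

Section nondecreasing_C1.
Context {R : realType}.
Local Notation mu := (@lebesgue_measure R).
Variables (a b : R) (a_lt_b : a < b) (f : R -> R) (f_C1 : C1_itv a b f).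
Hypothesis f_ge0 : forall t : R, t \in `[a, b] -> 0 <= f t.
Hypothesis f_nd : {in `[a, b] &, {homo f : x y / x <= y}}.

(** For small [h] the point [h + x] stays in []a, b[], where monotonicity makes the difference
    quotient nonnegative; the sign passes to the limit. *)
Lemma C1_derive1_ge0 (x : R) : x \in `]a, b[ -> 0 <= derive1 f x.
Proof.
case: f_C1 => -[df _ _] _ xab.
rewrite derive1E /derive; apply: limr_ge; first exact: df.
near=> h.
have hab : h + x \in `]a, b[.
  near: h; apply: nbhs_dnbhs.
  have cx : continuous (fun h : R => h + x).
    by move=> z; apply: cvgD => //; exact: cvg_cst.
  have := cx 0 [set` `]a, b[]; rewrite add0r; apply.
  by apply: open_nbhs_nbhs; split => //; exact: interval_open.
have sub := @subset_itv_oo_cc _ _ a b.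
rewrite /= [h *: 1]mulr1 /GRing.scale/= mulrC.
have [h0|h0|->] := ltgtP h 0; last by rewrite invr0 mulr0.
- rewrite nmulr_lge0 ?invr_lt0// subr_le0; apply: f_nd; [exact: sub|exact: sub|lra].
- rewrite pmulr_lge0 ?invr_gt0// subr_ge0; apply: f_nd; [exact: sub|exact: sub|lra].
Unshelve. all: by end_near. Qed.

Lemma C1_within_continuous : {within `[a, b], continuous f}.
Proof. by case: f_C1 => df _; exact: derivable_oo_LRcontinuous_within. Qed.

Lemma measurable_C1_restrict : measurable_fun [set: R] (f \_ `[a, b]).
Proof.
apply/(measurable_restrictT f) => //.
by apply: subspace_continuous_measurable_fun => //; exact: C1_within_continuous.
Qed.

Lemma measurable_derive1_restrict : measurable_fun [set: R] (derive1 f \_ `]a, b[).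
Proof.
case: f_C1 => _ [g cg fg].
rewrite (_ : derive1 f \_ _ = g \_ `]a, b[); last first.
  apply/funext => x; rewrite !patchE; case: ifPn => // /set_mem/= xab.
  exact: fg.
apply/(measurable_restrictT g) => //.
apply: (@measurable_funS _ _ _ _ `[a, b]) => //; first exact: subset_itv_oo_cc.
exact: subspace_continuous_measurable_fun.
Qed.

Lemma C1_restrict_ge0 t : 0 <= (f \_ `[a, b]) t.
Proof. by rewrite patchE; case: ifPn => // /set_mem; exact: f_ge0. Qed.

Lemma derive1_restrict_ge0 t : 0 <= (derive1 f \_ `]a, b[) t.
Proof. by rewrite patchE; case: ifPn => // /set_mem; exact: C1_derive1_ge0. Qed.

(** The increment is the integral of the derivative over []x, y[]. The condition [u - v <= t <= u]
    means that [u] lies in [[t, t + v]], which contains []x, y[]; since the derivative is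
    nonnegative, the larger domain only increases the integral. *)
Lemma C1_increment_le (x y t v : R) : a <= x -> x <= y -> y <= b ->
  t <= x -> y <= t + v ->
  ((f y - f x)%:E <= \int[mu]_u
    (if (u - v <= t <= u)%R then (derive1 f \_ `]a, b[) u else 0)%:E)%E.
Proof.
move=> ax; rewrite le_eqVlt => /predU1P[-> _ _ _|xy yb tx ytv].
  rewrite subrr; apply: integral_ge0 => u _.
  by rewrite lee_fin; case: ifP => // _; exact: derive1_restrict_ge0.
have sub : `[x, y] `<=` `[a, b] by apply: subset_itv; rewrite bnd_simp.
have subo : `]x, y[ `<=` `]a, b[ by apply: subset_itv; rewrite bnd_simp.
case: (f_C1) => -[df fa fb] [g cg fg].
have cf : {within `[x, y], continuous f}.
  by apply: continuous_subspaceW C1_within_continuous.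
(* The fundamental theorem is applied to the continuous extension [g], because [derive1 f] is
   controlled on the open interval only. *)
rewrite EFinB -(@continuous_FTC2 _ g f x y xy); last 3 first.
- exact: continuous_subspaceW cg.
- move/(continuous_within_itvP _ xy) : cf => -[_ ? ?]; split => //.
  by move=> z zxy; apply: df; exact: subo.
- by move=> z zxy; apply: fg; exact: subo.
have mg : measurable_fun `]x, y[ g.
  apply: (@measurable_funS _ _ _ _ `[a, b]) => //.
    by apply: subset_trans sub; exact: subset_itv_oo_cc.
  exact: subspace_continuous_measurable_fun.
rewrite integral_itv_bndoo; last exact/measurable_EFinP.
rewrite integral_mkcond; apply: ge0_le_integral => //=.
- move=> u _; rewrite patchE; case: ifPn => // /set_mem/= uxy.
  by rewrite lee_fin -fg ?C1_derive1_ge0//; exact: subo.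
- by apply/(measurable_restrictT (EFin \o g)) => //; exact/measurable_EFinP.
- apply/measurable_EFinP; apply: measurable_fun_ifT => //=.
    by apply: measurable_and; apply: measurable_fun_ler => //; exact: measurable_funB.
  exact: measurable_derive1_restrict.
- move=> u _; rewrite patchE; case: ifPn => [/set_mem/= uxy|_].
    have := uxy; rewrite in_itv/= => /andP[xu uy].
    rewrite ifT; last by apply/andP; split; lra.
    by rewrite patchE mem_set ?fg//=; exact: subo.
  by rewrite lee_fin; case: ifP => // _; exact: derive1_restrict_ge0.
Qed.

(** The hypothesis of [left_increment_ub], with [A] equal to [f a]. If [t + v] is outside [[a, b]]
    the left side is 0. Otherwise the growth runs over [[t, t + v]] when [a <= t]; when [t < a] it
    runs over [[a, t + v]], and the jump [f a] is added because [t] then lies in the window at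
    [a]. *)
Lemma C1_restrict_ub (t v : R) : 0 <= v ->
  (((f \_ `[a, b]) (t + v))%:E <= ((f \_ `[a, b]) t)%:E +
    ((if (a - v <= t <= a)%R then f a else 0)%:E +
     \int[mu]_u (if (u - v <= t <= u)%R then (derive1 f \_ `]a, b[) u else 0)%:E))%E.
Proof.
move=> v0.
have i0 : (0 <= \int[mu]_u
    (if (u - v <= t <= u)%R then (derive1 f \_ `]a, b[) u else 0)%:E)%E.
  apply: integral_ge0 => u _.
  by rewrite lee_fin; case: ifP => // _; exact: derive1_restrict_ge0.
have fa : 0 <= f a by apply: f_ge0; rewrite in_itv/= lexx ltW.
have A0 : 0 <= (if (a - v <= t <= a)%R then f a else 0) by case: ifP.
have [tvab|tvab] := boolP (t + v \in `[a, b]); last first.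
  rewrite [in leLHS]patchE memNset//=; last exact/negP.
  by apply: adde_ge0; [rewrite lee_fin C1_restrict_ge0|apply: adde_ge0].
rewrite [in leLHS]patchE mem_set//=.
move: (tvab); rewrite in_itv/= => /andP[atv tvb].
have [at_|ta] := leP a t.
  rewrite patchE mem_set/=; last by rewrite in_itv/= at_/=; lra.
  have := @C1_increment_le t (t + v) t v at_ _ tvb (lexx _) (lexx _).
  rewrite lerDl => /(_ v0) h.
  apply: (@le_trans _ _ ((f t)%:E + (f (t + v) - f t)%:E)%E).
    by rewrite -EFinD lee_fin; lra.
  apply: leeD2l; apply: le_trans h _.
  by rewrite leeDr// lee_fin.
rewrite patchE memNset/=; last by rewrite in_itv/=; lra.
rewrite add0e ifT; last by apply/andP; split; lra.
have := @C1_increment_le a (t + v) t v (lexx _) atv tvb (ltW ta) (lexx _).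
move=> h; apply: (@le_trans _ _ ((f a)%:E + (f (t + v) - f a)%:E)%E).
  by rewrite -EFinD lee_fin; lra.
exact: leeD2l.
Qed.

(** The hypothesis of [right_increment_ub], with [B] equal to [f b]. Monotonicity suffices while
    [t + v <= b]; past [b], the point [t] lies in the window at [b] and [f t <= f b]. *)
Lemma C1_restrict_lb (t v : R) : 0 <= v ->
  (f \_ `[a, b]) t <= (f \_ `[a, b]) (t + v) + (if b - v <= t <= b then f b else 0).
Proof.
move=> v0.
have fb : 0 <= f b by apply: f_ge0; rewrite in_itv/= lexx ltW.
have B0 : 0 <= (if b - v <= t <= b then f b else 0) by case: ifP.
have [tab|tab] := boolP (t \in `[a, b]); last first.
  rewrite [in leLHS]patchE memNset//=; last exact/negP.
  by rewrite addr_ge0// C1_restrict_ge0.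
rewrite [in leLHS]patchE mem_set//=.
move: (tab); rewrite in_itv/= => /andP[at_ tb].
have [tvb|btv] := leP (t + v) b.
  have tvab : t + v \in `[a, b] by rewrite in_itv/=; apply/andP; split; lra.
  rewrite patchE mem_set//=.
  apply: (@le_trans _ _ (f (t + v))); last by rewrite lerDl.
  by apply: (f_nd tab tvab); rewrite lerDl.
rewrite ifT; last by apply/andP; split; lra.
apply: (@le_trans _ _ (f b)); last by rewrite lerDr C1_restrict_ge0.
by apply: f_nd => //; rewrite in_itv/= lexx ltW.
Qed.

End nondecreasing_C1.

(** * First moments of the kernel: finiteness, tails, scaling *)

Section kernel_moment.
Context {R : realType}.
Local Notation mu := (@lebesgue_measure R).

Lemma integral_powR_moment (m : R) : 0 < m ->
  (\int[mu]_(u in `[0%R, +oo[) (u * (1 + u ^+ 2) `^ (- m - 1))%:E =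
   ((2 * m)^-1)%:E)%E.
Proof.
move=> m0.
have pos (u : R) : 0 < 1 + u ^+ 2 by rewrite ltr_pwDl// sqr_ge0.
(* [G] is the antiderivative [- (2 m)^-1 (1 + u^2)^(- m)], with the power written through [expR] and
   [ln] so that the chain rule applies. It vanishes at infinity, and [- G 0] is the value of the
   integral. *)
pose G (u : R) := - (2 * m)^-1 * expR (- m * ln (1 + u ^+ 2)).
have powE (p u : R) : (1 + u ^+ 2) `^ p = expR (p * ln (1 + u ^+ 2)).
  by rewrite /powR gt_eqF.
have dG (u : R) : is_derive u 1 G (u * (1 + u ^+ 2) `^ (- m - 1)).
  have dln : is_derive (1 + u ^+ 2) 1 (@ln R) (1 + u ^+ 2)^-1 by exact: is_derive1_ln.
  have dsq : is_derive u 1 (fun u : R => 1 + u ^+ 2) (2 * u).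
    by apply: is_derive_eq; rewrite ?add0r/= /GRing.scale/=; ring.
  have dc : is_derive u 1 (fun u : R => ln (1 + u ^+ 2)) ((1 + u ^+ 2)^-1 * (2 * u)).
    exact: (is_derive1_comp (f := @ln R) (g := fun u : R => 1 + u ^+ 2)).
  have dm : is_derive u 1 (fun u : R => - m * ln (1 + u ^+ 2))
      (- m * ((1 + u ^+ 2)^-1 * (2 * u))).
    exact: is_deriveZ.
  have de : is_derive u 1 (fun u : R => expR (- m * ln (1 + u ^+ 2)))
      (expR (- m * ln (1 + u ^+ 2)) * (- m * ((1 + u ^+ 2)^-1 * (2 * u)))).
    exact: (is_derive1_comp (f := @expR R) (g := fun u : R => - m * ln (1 + u ^+ 2))).
  rewrite (_ : u * _ = - (2 * m)^-1 *
      (expR (- m * ln (1 + u ^+ 2)) * (- m * ((1 + u ^+ 2)^-1 * (2 * u))))).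
    exact: is_deriveZ.
  rewrite powE mulrBl mul1r expRB lnK ?posrE//.
  by field; rewrite !gt_eqF.
have cf : continuous (fun u : R => u * (1 + u ^+ 2) `^ (- m - 1)).
  move=> u; apply: cvgM; first exact: cvg_id.
  under eq_fun do rewrite powE; rewrite powE.
  apply: (@continuous_comp _ _ _ (fun u : R => (- m - 1) * ln (1 + u ^+ 2)) expR).
    apply: cvgM; first exact: cvg_cst.
    apply: (@continuous_comp _ _ _ (fun u : R => 1 + u ^+ 2) (@ln R)).
      by apply: cvgD; [exact: cvg_cst|exact: exprn_continuous].
    exact: continuous_ln.
  exact: continuous_expR.
rewrite (@ge0_continuous_FTC2y _ _ G _ 0).
- by rewrite -EFinB /G expr0n/= addr0 ln1 mulr0 expR0 mulr1 opprK add0r.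
- by move=> x x0; rewrite mulr_ge0// powR_ge0.
- exact: continuous_subspaceT.
- rewrite /G -(mulr0 (- (2 * m)^-1)); apply: cvgM; first exact: cvg_cst.
  rewrite (_ : (fun x => expR _) =
      (fun z => expR (- z)) \o (fun u : R => m * ln (1 + u ^+ 2))).
    apply: (@cvg_comp _ _ _ _ _ _ (pinfty_nbhs R)); last exact: cvgr_expR.
    (* As [u <= 1 + u ^+ 2] for [u >= 1], it is enough that [u] exceeds [expR (A / m)]. *)
    apply/cvgryPge => A; near=> u.
    have u1 : 1 <= u by near: u; exact: nbhs_pinfty_ge.
    have uA : expR (A / m) <= u by near: u; apply: nbhs_pinfty_ge; rewrite num_real.
    rewrite mulrC -ler_pdivrMr// -ler_expR lnK ?posrE//; nra.
  by apply/funext => u /=; rewrite mulNr.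
- by move=> x _; apply: ex_derive.
- apply/cvg_at_right_filter/differentiable_continuous/derivable1_diffP.
  exact: ex_derive.
- by move=> x _; rewrite derive1E; apply: derive_val.
Unshelve. all: by end_near. Qed.


Section moment.
Variable rho : R -> R.
Hypotheses (rho_cont : continuous rho) (rho_ge0 : forall t, 0 <= rho t).
Hypothesis rho_even : forall t, rho (- t) = rho t.
Hypothesis rho_decay : exists m C : R,
  0 < m /\ forall t : R, `|rho t| <= C * (1 + t ^+ 2) `^ (- m - 1).

Let mg : measurable_fun [set: R] (fun u => u * rho u).
Proof. by apply: measurable_funM => //; exact: continuous_measurable_fun. Qed.

(** The decay bound dominates the integrand by a multiple of [u (1 + u^2)^(- m - 1)], whose integral
    is finite because [m > 0]. *)
Lemma kernel_moment_lty :
  (\int[mu]_(u in `[0%R, +oo[) (u * rho u)%:E < +oo)%E.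
Proof.
have [m [C [m0 rhoC]]] := rho_decay.
have C0 : 0 <= C.
  have := le_trans (normr_ge0 _) (rhoC 0).
  by rewrite expr0n addr0 powR1 mulr1.
have mp : measurable_fun [set: R] (fun u : R => u * (1 + u ^+ 2) `^ (- m - 1)).
  apply: measurable_funM => //.
  apply: (measurableT_comp (f := @powR R ^~ (- m - 1))
    (g := fun u : R => 1 + u ^+ 2)) => //.
  by apply: measurable_funD => //; exact: exprn_measurable.
apply: (@le_lt_trans _ _ (\int[mu]_(u in `[0%R, +oo[)
    (C%:E * (u * (1 + u ^+ 2) `^ (- m - 1))%:E))%E).
  apply: ge0_le_integral => //=.
  - by move=> u; rewrite in_itv/= andbT => u0; rewrite lee_fin mulr_ge0.
  - by apply/measurable_EFinP; exact: measurable_funTS.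
  - apply: emeasurable_funM => //; apply/measurable_EFinP.
    exact: measurable_funTS.
  - move=> u; rewrite in_itv/= andbT => u0; rewrite -EFinM lee_fin mulrCA.
    by rewrite ler_wpM2l// (le_trans (ler_norm _)).
rewrite ge0_integralZl_EFin//; first by rewrite integral_powR_moment// -EFinM ltry.
- by move=> u /=; rewrite in_itv/= andbT => u0; rewrite lee_fin mulr_ge0 ?powR_ge0.
- by apply/measurable_EFinP; exact: measurable_funTS.
Qed.

(** An extended-real form of [moment_kernel1] with the cutoff inside the integrand, so that
    measurability in [x] follows from joint measurability in [x] and [u]. *)
Definition kernel_tail_moment (x : R) : \bar R :=
  \int[mu]_u (if x <= u then u * rho u else 0)%:E.

Let tail_ge0 (x u : R) : 0 <= x -> 0 <= (if x <= u then u * rho u else 0).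
Proof. by move=> x0; case: ifPn => // xu; rewrite mulr_ge0// (le_trans x0). Qed.

Let mtail (x : R) : measurable_fun [set: R] (fun u => if x <= u then u * rho u else 0).
Proof. by apply: measurable_fun_ifT => //=; exact: measurable_fun_ler. Qed.

Lemma kernel_tail_momentE (x : R) :
  kernel_tail_moment x = (\int[mu]_(u in `[x, +oo[) (u * rho u)%:E)%E.
Proof.
rewrite [RHS]integral_mkcond; apply: eq_integral => u _.
by rewrite patchE mem_setE in_itv/= andbT; case: ifP.
Qed.

Lemma kernel_tail_moment_ge0 (x : R) : 0 <= x -> (0 <= kernel_tail_moment x)%E.
Proof. by move=> x0; apply: integral_ge0 => u _; rewrite lee_fin tail_ge0. Qed.

Lemma kernel_tail_moment_ninc (x y : R) : 0 <= x -> x <= y ->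
  (kernel_tail_moment y <= kernel_tail_moment x)%E.
Proof.
move=> x0 xy; apply: ge0_le_integral => //=.
- by move=> u _; rewrite lee_fin tail_ge0// (le_trans x0).
- apply/measurable_EFinP; exact: mtail.
- apply/measurable_EFinP; exact: mtail.
- move=> u _; rewrite lee_fin; case: ifPn => [yu|_]; last exact: tail_ge0.
  by rewrite (le_trans xy yu).
Qed.

Lemma kernel_tail_moment_fin (x : R) : 0 <= x -> kernel_tail_moment x \is a fin_num.
Proof.
move=> x0; rewrite ge0_fin_numE ?kernel_tail_moment_ge0//.
apply: le_lt_trans (kernel_tail_moment_ninc (lexx _) x0) _.
by rewrite kernel_tail_momentE kernel_moment_lty.
Qed.

(* For [x < 0] the integrand [u * rho u] is odd and cancels on [x, - x]. *)
Lemma moment_kernel1E (x : R) :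
  (moment_kernel1 rho x)%:E = kernel_tail_moment `|x|.
Proof.
rewrite /moment_kernel1 /Rintegral -kernel_tail_momentE.
have [x0|x0] := leP 0 x; first by rewrite fineK ?ger0_norm// kernel_tail_moment_fin.
have x0' : 0 <= - x by rewrite oppr_ge0 ltW.
pose B := (\int[mu]_u (if 0 <= u <= - x then u * rho u else 0)%:E)%E.
pose C := (\int[mu]_u (if - x < u then u * rho u else 0)%:E)%E.
have B0 (u : R) : 0 <= (if 0 <= u <= - x then u * rho u else 0).
  by case: ifPn => // /andP[u0 _]; rewrite mulr_ge0.
have C0 (u : R) : 0 <= (if - x < u then u * rho u else 0).
  by case: ifPn => // xu; rewrite mulr_ge0//; lra.
have mB : measurable_fun [set: R] (fun u : R => if 0 <= u <= - x then u * rho u else 0).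
  apply: measurable_fun_ifT => //=.
  by apply: measurable_and; exact: measurable_fun_ler.
have mC : measurable_fun [set: R] (fun u : R => if - x < u then u * rho u else 0).
  by apply: measurable_fun_ifT => //=; exact: measurable_fun_ltr.
have CE : C = kernel_tail_moment (- x).
  rewrite kernel_tail_momentE -integral_itv_obnd_cbnd; last first.
    by apply/measurable_EFinP; exact: measurable_funTS.
  rewrite [RHS]integral_mkcond; apply: eq_integral => u _.
  by rewrite patchE mem_setE in_itv/= andbT; case: ifP.
have ABC : kernel_tail_moment 0 = (B + C)%E.
  rewrite -ge0_integralD//; last 4 first.
  - by move=> u _; rewrite lee_fin.
  - exact/measurable_EFinP.
  - by move=> u _; rewrite lee_fin.
  - exact/measurable_EFinP.
  apply: eq_integral => u _; rewrite -EFinD; congr EFin.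
  have [u0|u0] := leP 0 u; have [xu|xu] := leP u (- x); rewrite ?addr0 ?add0r//=.
  by exfalso; lra.
(* Finiteness allows [B] to be cancelled from [B + C - B] in the extended reals; this is the
   cancellation of the odd part. *)
have Bfin : B \is a fin_num.
  rewrite ge0_fin_numE; last by apply: integral_ge0 => u _; rewrite lee_fin.
  apply: (@le_lt_trans _ _ (kernel_tail_moment 0)).
    by rewrite ABC leeDl// CE kernel_tail_moment_ge0.
  by rewrite -ge0_fin_numE ?kernel_tail_moment_fin// kernel_tail_moment_ge0.
rewrite ltr0_norm// -CE {1}/kernel_tail_moment integralE.
rewrite (_ : (\int[mu]_u _^\+ _)%E = kernel_tail_moment 0); last first.
  apply: eq_integral => u _; rewrite funeposE -EFin_max; congr EFin.
  have [u0|u0] := leP 0 u.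
    rewrite ifT; last by lra.
    by apply/max_idPl; rewrite mulr_ge0.
  case: ifP => _; apply/max_idPr => //.
  by rewrite nmulr_rle0.
rewrite (_ : (\int[mu]_u _^\- _)%E = B); last first.
  rewrite /B -[RHS](@ge0_integral_reflect _ 0)//; last first.
    exact/measurable_EFinP.
  apply: eq_integral => u _; rewrite funenegE -EFinN -EFin_max; congr EFin.
  rewrite sub0r lerN2 oppr_ge0 rho_even.
  have [u0|u0] := leP u 0; case: ifPn => // xu; rewrite ?mulNr;
    apply/max_idPl || apply/max_idPr.
  - by rewrite -mulNr mulr_ge0// oppr_ge0.
  - by rewrite oppr0.
  - by rewrite oppr_le0 mulr_ge0// ltW.
  - by rewrite oppr0.
rewrite ABC addeAC subee// add0e fineK// CE.
exact: kernel_tail_moment_fin.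
Qed.

Lemma moment_kernel_ge0 (delta x : R) : 0 < delta -> 0 <= moment_kernel delta rho x.
Proof.
move=> d0; apply: mulr_ge0; first exact: ltW.
by rewrite -lee_fin moment_kernel1E kernel_tail_moment_ge0.
Qed.

Lemma measurable_moment_kernel (delta : R) :
  measurable_fun [set: R] (moment_kernel delta rho).
Proof.
apply: measurable_funM => //.
apply: (measurableT_comp (f := moment_kernel1 rho)); last exact: measurable_funM.
apply/measurable_EFinP.
rewrite (_ : EFin \o _ = fun x => kernel_tail_moment `|x|); last first.
  by apply/funext => x /=; exact: moment_kernel1E.
apply: (@measurable_integral_EFin _ _ _ _ _ mu
  (fun x u : R => if `|x| <= u then u * rho u else 0)) => /=.
- apply: measurable_fun_ifT => //=.
    by apply: measurable_fun_ler => //; exact: measurableT_comp.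
  exact: (measurableT_comp mg).
- by move=> x u; exact: tail_ge0.
Qed.

Definition half_kernel (T v : R) : R := if 0 < v then scaled_kernel T rho v else 0.

(** This is the source of the constant. The substitution [u = T v] turns the left side into [T^-1]
    times the tail moment at [|T s|]. As [delta <= T], that is at most the tail moment at
    [|delta s|], and [rho_{1,0} (delta s)] is [delta^-1 rho_{delta,0} (s)]. *)
Lemma half_kernel_moment_le (T delta s : R) : 0 < delta -> delta <= T ->
  (\int[mu]_v (half_kernel T v * (if `|s| <= v then v else 0))%:E <=
   (T^-1 * delta^-1 * moment_kernel delta rho s)%:E)%E.
Proof.
move=> d0 dT; have T0 : 0 < T := lt_le_trans d0 dT.
have -> : (\int[mu]_v (half_kernel T v * (if `|s| <= v then v else 0))%:E)%E =
    (\int[mu]_v (if `|T * s| <= T * v then (T * v) * rho (T * v) else 0)%:E)%E.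
  apply: eq_integral => v _; congr EFin.
  rewrite normrM gtr0_norm// ler_pM2l// /half_kernel /scaled_kernel.
  case: ifPn => v0; case: ifPn => sv; rewrite ?mulr0//; first by ring.
  (* Here [|s| <= v <= 0], which leaves [v = 0], where the factor [T * v] vanishes. *)
  have -> : v = 0 by apply/eqP; rewrite eq_le -leNgt in v0 *; rewrite v0 (le_trans _ sv).
  by rewrite !(mulr0, mul0r).
have E : kernel_tail_moment `|T * s| = (T%:E *
    \int[mu]_v (if `|T * s| <= T * v then (T * v) * rho (T * v) else 0)%:E)%E.
  apply: (@ge0_integral_scale _ T
    (fun u => (if `|T * s| <= u then u * rho u else 0)%:E)) => //.
  - apply/measurable_EFinP; exact: mtail.
  - by move=> u; rewrite lee_fin tail_ge0.
rewrite -(@lee_pmul2l _ T%:E) ?lte_fin// -E /moment_kernel -EFinM.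
rewrite (_ : T * (T^-1 * _ * _) = moment_kernel1 rho (delta * s)); last first.
  by field; rewrite !gt_eqF.
rewrite moment_kernel1E; apply: kernel_tail_moment_ninc => //.
by rewrite !normrM (gtr0_norm d0) (gtr0_norm T0) ler_wpM2r.
Qed.

End moment.
End kernel_moment.

(** * The Stieltjes measure of [F] and convolution against it *)

Section stieltjes.
Context {R : realType}.
Local Notation mu := (@lebesgue_measure R).
Variables (F : R -> R) (F_nd : nondecreasing F).
Local Notation nu := (lebesgue_stieltjes_measure (right_limit F_nd)).

(** The mass of a closed interval is [F (y + 0) - F (x - 0)], which includes the full jumps at both
    ends. It is the limit of the masses of []x - 1/(n + 1), y]], and each of these already
    dominates, since the right limit at [x - 1/(n + 1)] is at most [F x]. *)
Lemma stieltjes_itv_ge (x y : R) : x <= y -> ((F y - F x)%:E <= nu `[x, y])%E.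
Proof.
move=> xy.
pose A (n : nat) : set (measurableTypeR R) := `]x - n.+1%:R^-1, y]%classic.
have AE : \bigcap_n A n = `[x, y]%classic.
  apply/seteqP; split => z /=.
    move=> zA; have := zA 0%N I; rewrite /A /= !in_itv/= => /andP[_ ->]; rewrite andbT.
    apply/ler_addgt0Pr => e e0; near \oo => n.
    have := zA n I; rewrite /A /= in_itv/= => /andP[+ _].
    have : n.+1%:R^-1 < e by near: n; exact: near_infty_natSinv_lt (PosNum e0).
    by move: (_^-1) => i; lra.
  rewrite in_itv/= => /andP[xz zy] n _; rewrite /A /= in_itv/= zy andbT.
  by rewrite (lt_le_trans _ xz)// ltrBlDr ltrDl invr_gt0.
have nuA n : nu (A n) = (right_limit F_nd y - right_limit F_nd (x - n.+1%:R^-1))%:E.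
  have xny : x - n.+1%:R^-1 < y.
    by rewrite (lt_le_trans _ xy)// ltrBlDr ltrDl invr_gt0.
  rewrite /A /lebesgue_stieltjes_measure/= /measure_extension/=.
  rewrite measurable_mu_extE/=; last exact: is_ocitv.
  by rewrite wlength_itv/= lte_fin xny -EFinB.
have cvgA : nu (A n) @[n --> \oo] --> nu `[x, y].
  rewrite -AE; apply: nonincreasing_cvg_mu => //=.
  - by rewrite nuA ltry.
  - by move=> n; exact: measurable_itv.
  - by rewrite AE; exact: measurable_itv.
  - move=> m n mn; apply/subsetPset; apply: subset_itvr; rewrite bnd_simp.
    by rewrite lerB// lef_pV2 ?posrE// ler_nat.
rewrite -(cvg_lim _ cvgA)//; apply: lime_ge; first by apply/cvg_ex; exists (nu `[x, y]).
apply: nearW => n; rewrite nuA lee_fin lerB ?right_limit_ge//.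
by apply: right_limit_le; rewrite ltrBlDr ltrDl invr_gt0.
Unshelve. all: by end_near. Qed.

(** For a nonnegative integrand the partial integrals increase with [r], so their limit exists and
    may be computed along the integers, where monotone convergence identifies it. *)
Lemma convol_stieltjesE (g : R -> R) (t : R) : measurable_fun [set: R] g ->
  (forall x, 0 <= g x) ->
  convol_stieltjes g F_nd t = (\int[nu]_s (g (t - s))%:E)%E.
Proof.
move=> mg g0.
have mgt : measurable_fun [set: R] (fun s : R => (g (t - s))%:E).
  apply/measurable_EFinP; apply: (measurableT_comp mg).
  exact: measurable_funB.
have nd : nondecreasing_fun (convol_stieltjes_partial g F_nd t).
  move=> r s rs; apply: ge0_subset_integral => //=.
  - exact: measurable_funTS.
  - by move=> z _; rewrite lee_fin.
  - by apply: subset_itv; rewrite bnd_simp ?lerN2.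
have cvg_sup := nondecreasing_cvge nd.
rewrite /convol_stieltjes (cvg_lim _ cvg_sup)//.
have h1 : (convol_stieltjes_partial g F_nd t) n%:R @[n --> \oo] -->
    ereal_sup (range (convol_stieltjes_partial g F_nd t)).
  exact: (cvg_comp _ _ (@cvgr_idn R) cvg_sup).
have h2 : (convol_stieltjes_partial g F_nd t) n%:R @[n --> \oo] -->
    (\int[nu]_s (g (t - s))%:E)%E.
  have -> : [set: measurableTypeR R] =
      \bigcup_n (`](- n%:R : R), (n%:R : R)[%classic : set (measurableTypeR R)).
    apply/seteqP; split => // z _.
    exists (Num.bound `|z|) => //=; rewrite in_itv/= -ltr_norml.
    exact: archi_boundP (normr_ge0 z).
  apply: ge0_nondecreasing_set_cvg_integral => //=.
  - move=> m n mn; apply/subsetPset; apply: subset_itv; rewrite bnd_simp ?lerN2 ler_nat//.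
  - by move=> n; exact: measurable_funTS.
  - by move=> n z _; rewrite lee_fin.
exact: (cvg_unique _ h1 h2).
Qed.

Lemma measurable_convol_stieltjes (g : R -> R) : measurable_fun [set: R] g ->
  (forall x, 0 <= g x) ->
  measurable_fun [set: R] (convol_stieltjes g F_nd).
Proof.
move=> mg g0.
rewrite (_ : convol_stieltjes g F_nd = fun t => (\int[nu]_s (g (t - s))%:E)%E); last first.
  by apply/funext => t; exact: convol_stieltjesE.
apply: (@measurable_integral_EFin _ _ _ _ _ nu (fun t s : R => g (t - s))) => //=.
apply: (measurableT_comp mg); exact: measurable_funB.
Qed.

Section moment_bound.
Variables (w : R -> R) (mw : measurable_fun [set: R] w).
Hypotheses (w_ge0 : forall v, 0 <= w v) (w0 : forall v, v <= 0 -> w v = 0).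

(** The increment [F (t + v) - F (t - v)] is at most the mass of the points [s] with [|t - s| <= v];
    exchanging the integrals gathers the total weight in [v] attached to each [s]. *)
Lemma moment_increment_tonelli (t : R) :
  (moment_increment F w t <=
   \int[nu]_s \int[mu]_v (w v * (if `|t - s| <= v then v else 0))%:E)%E.
Proof.
pose h (v s : R) := w v * (if `|t - s| <= v then v else 0).
have h0 v s : 0 <= h v s.
  by rewrite mulr_ge0//; case: ifPn => // /(le_trans _); exact.
have mh : measurable_fun [set: R * R] (fun z : R * R => h z.1 z.2).
  apply: measurable_funM; first exact: measurableT_comp.
  apply: measurable_fun_ifT => //=.
  apply: measurable_fun_ler => //; apply: measurableT_comp => //.
  exact: measurable_funB.
rewrite -(@tonelli_EFin _ _ _ _ _ mu nu h)//.
apply: ge0_le_integral => //=.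
- by move=> v _; rewrite lee_fin; exact: moment_weight_ge0.
- apply/measurable_EFinP.
  apply: (measurableT_comp (measurable_moment_weight F_nd mw) (g := fun v : R => (t, v))).
  exact: measurable_fun_pair.
- exact: (@measurable_integral_EFin _ _ _ _ _ nu h).
- move=> v _; have [v0|v0] := leP v 0.
    by rewrite w0// mul0r; apply: integral_ge0 => s _; rewrite lee_fin.
  have -> : (\int[nu]_s (h v s)%:E = (w v * v)%:E * nu `[(t - v)%R, (t + v)%R])%E.
    rewrite -integral_cst; last exact: measurable_itv.
    rewrite [RHS]integral_mkcond; apply: eq_integral => s _.
    rewrite patchE mem_setE in_itv/= /h ler_distl.
    rewrite (_ : (s - v <= t <= s + v) = (t - v <= s <= t + v)).
      by case: ifP => _ //; rewrite mulr0.
    by apply/idP/idP => /andP[? ?]; apply/andP; split; lra.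
  rewrite mulrA EFinM; apply: lee_wpmul2l.
    by rewrite lee_fin mulr_ge0// ltW.
  apply: stieltjes_itv_ge; lra.
Qed.
End moment_bound.

End stieltjes.

(** * Moments of the increments bounded by the convolution [rho_{delta,0} * F'] *)

Section half_kernel.
Context {R : realType}.
Local Notation mu := (@lebesgue_measure R).
Variables (F : R -> R) (F_nd : nondecreasing F).
Local Notation nu := (lebesgue_stieltjes_measure (right_limit F_nd)).
Variable rho : R -> R.
Hypotheses (rho_cont : continuous rho) (rho_ge0 : forall t, 0 <= rho t).
Hypothesis rho_even : forall t, rho (- t) = rho t.
Hypothesis rho_decay : exists m C : R,
  0 < m /\ forall t : R, `|rho t| <= C * (1 + t ^+ 2) `^ (- m - 1).
Variables (T delta : R) (delta_gt0 : 0 < delta) (delta_le_T : delta <= T).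

Lemma scaled_kernel_ge0 v : 0 <= scaled_kernel T rho v.
Proof. by rewrite mulr_ge0// (le_trans _ delta_le_T)// ltW. Qed.

Lemma measurable_scaled_kernel : measurable_fun [set: R] (scaled_kernel T rho).
Proof.
apply: measurable_funM => //.
apply: (measurableT_comp (f := rho)); last exact: measurable_funM.
exact: continuous_measurable_fun.
Qed.

Lemma half_kernel_ge0 v : 0 <= half_kernel rho T v.
Proof. by rewrite /half_kernel; case: ifP => // _; exact: scaled_kernel_ge0. Qed.

Lemma half_kernel0 v : v <= 0 -> half_kernel rho T v = 0.
Proof. by rewrite /half_kernel leNgt => /negbTE ->. Qed.

Lemma measurable_half_kernel : measurable_fun [set: R] (half_kernel rho T).
Proof.
apply: measurable_fun_ifT => //=; first exact: measurable_fun_ltr.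
exact: measurable_scaled_kernel.
Qed.

Lemma moment_increment_le (t : R) :
  (moment_increment F (half_kernel rho T) t <=
   (T^-1 * delta^-1)%:E * convol_stieltjes (moment_kernel delta rho) F_nd t)%E.
Proof.
apply: (le_trans (moment_increment_tonelli F_nd measurable_half_kernel
  half_kernel_ge0 half_kernel0 t)).
have mk : measurable_fun [set: R] (fun s : R => (moment_kernel delta rho (t - s))%:E).
  apply/measurable_EFinP.
  apply: (measurableT_comp
    (measurable_moment_kernel rho_cont rho_ge0 rho_even rho_decay delta)).
  exact: measurable_funB.
rewrite convol_stieltjesE; [|exact: measurable_moment_kernel
  |by move=> x; exact: moment_kernel_ge0].
have Td0 : 0 <= T^-1 * delta^-1.
  by rewrite mulr_ge0// invr_ge0 ltW// (lt_le_trans delta_gt0).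
rewrite -ge0_integralZl_EFin//; last first.
  by move=> s _; rewrite lee_fin; exact: moment_kernel_ge0.
apply: ge0_le_integral => //=.
- move=> s _; apply: integral_ge0 => v _; rewrite lee_fin.
  by rewrite mulr_ge0 ?half_kernel_ge0//; case: ifPn => // /(le_trans _); exact.
- apply: (@measurable_integral_EFin _ _ _ _ _ mu
    (fun s v : R => half_kernel rho T v * (if `|t - s| <= v then v else 0))) => /=.
    apply: measurable_funM; first exact: (measurableT_comp measurable_half_kernel).
    apply: measurable_fun_ifT => //=.
    apply: measurable_fun_ler => //; apply: measurableT_comp => //.
    exact: measurable_funB.
  move=> s v.
  by rewrite mulr_ge0 ?half_kernel_ge0//; case: ifPn => // /(le_trans _); exact.
- exact: emeasurable_funM.
- by move=> s _; rewrite -EFinM; exact: half_kernel_moment_le.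
Qed.

End half_kernel.

(** * Symmetric improper integrals of integrable functions *)

Section improper_integral.
Context {R : realType}.
Local Notation mu := (@lebesgue_measure R).

(** The limit in the real parameter is tested along arbitrary sequences diverging to [+oo], to which
    dominated convergence applies with [|q|] as dominating function. *)
Lemma cvg_integral_symmetric_itv (q : R -> R) :
  mu.-integrable setT (fun u => (q u)%:E) ->
  \int[mu]_(u in `[- r, r]) q u @[r --> +oo] --> \int[mu]_u q u.
Proof.
move=> iq; apply/cvg_pinftyP => s sy.
have mq := measurable_int _ iq.
have fin := integrable_fin_num measurableT iq.
apply: fine_cvg; rewrite fineK//.
under eq_fun do rewrite integral_mkcond.
have [] // := @dominated_convergence _ _ _ mu setT measurableT
  (fun n => (EFin \o q) \_ `[- s n, s n]) (EFin \o q) (abse \o (EFin \o q)).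
- by move=> n; apply/(measurable_restrictT (EFin \o q)) => //; exact: measurable_funTS.
- apply: aeW => u _; apply: cvg_near_cst; near=> n.
  rewrite patchE mem_set//= in_itv/= -ler_norml.
  by near: n; move/cvgryPge : sy; exact.
- exact: integrable_abse.
- apply: aeW => u n _; rewrite patchE; case: ifPn => // _.
  by rewrite abse0; exact: abse_ge0.
Unshelve. all: by end_near. Qed.

End improper_integral.

(** * Convergence of [rho_T * F] and its expression by increments *)

Section convolution.
Context {R : realType}.
Local Notation mu := (@lebesgue_measure R).
Variables (F : R -> R) (F_nd : nondecreasing F).
Variable rho : R -> R.
Hypotheses (rho_cont : continuous rho) (rho_ge0 : forall t, 0 <= rho t).
Hypothesis rho_even : forall t, rho (- t) = rho t.
Hypothesis rho_int1 : \int[mu]_(t in [set: R]) rho t = 1.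
Variables (T : R) (T_gt0 : 0 < T).
Local Notation sigma := (scaled_kernel T rho).
Local Notation w := (half_kernel rho T).

Let sigma_ge0 v : 0 <= sigma v.
Proof. exact: (scaled_kernel_ge0 rho_ge0 T_gt0 (lexx T)). Qed.

Let msigma : measurable_fun [set: R] sigma.
Proof. exact: measurable_scaled_kernel. Qed.

Lemma integral_scaled_kernel (t : R) : (\int[mu]_u (sigma (t - u))%:E = 1)%E.
Proof.
rewrite (@ge0_integral_reflect _ t (fun u => (sigma u)%:E)); last 2 first.
- exact/measurable_EFinP.
- by move=> u; rewrite lee_fin.
have mrho : measurable_fun [set: R] rho by exact: continuous_measurable_fun.
transitivity (\int[mu]_u (rho u)%:E)%E.
  rewrite (@ge0_integral_scale _ T (fun u => (rho u)%:E))//; last exact/measurable_EFinP.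
  rewrite -ge0_integralZl_EFin//.
  - by move=> u _; rewrite lee_fin.
  - by apply/measurable_EFinP; apply: (measurableT_comp mrho); exact: measurable_funM.
  - exact: ltW.
(* The real-valued integral is the [fine] part of the extended one, which sends both infinities to
   0; the value 1 rules them out. *)
move: rho_int1; rewrite /Rintegral.
case: integral => [r /= ->//| |] /= /eqP; by rewrite eq_sym oner_eq0.
Qed.

(** The mass is in fact 1/2 by evenness; the bound 1 is enough for the finiteness it serves. *)
Lemma integral_half_kernel_le : (\int[mu]_v (w v)%:E <= 1)%E.
Proof.
rewrite -(integral_scaled_kernel 0); apply: ge0_le_integral => //=.
- by move=> v _; rewrite lee_fin /half_kernel; case: ifP.
- by apply/measurable_EFinP; exact: measurable_half_kernel.
- by apply/measurable_EFinP; apply: (measurableT_comp msigma); exact: measurable_funB.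
- move=> v _; rewrite lee_fin sub0r /half_kernel /scaled_kernel mulrN rho_even.
  by case: ifP => // _; rewrite mulr_ge0// ltW.
Qed.

Let w_ge0 v : 0 <= w v.
Proof. by rewrite /half_kernel; case: ifP. Qed.

Let mw : measurable_fun [set: R] w.
Proof. exact: measurable_half_kernel. Qed.

Let w0 v : v <= 0 -> w v = 0.
Proof. exact: half_kernel0. Qed.

Let mF : measurable_fun [set: R] F.
Proof. exact: nondecreasing_measurable. Qed.

(** The range is cut at [v = 1]. Below, [h] is at most [c] and [w] has mass at most 1; above,
    inserting the factor [v >= 1] only increases the integrand and produces the moment. *)
Lemma increment_integral_le (t c : R) (h : R -> R) : 0 <= c ->
  measurable_fun [set: R] (fun v => w v * h v) ->
  (forall v, 0 <= w v * h v) ->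
  (forall v, 0 < v -> v <= 1 -> h v <= c) ->
  (forall v, 1 <= v -> h v <= F (t + v) - F (t - v)) ->
  (\int[mu]_v (w v * h v)%:E <= c%:E + moment_increment F w t)%E.
Proof.
move=> c0 mh h0 hc hF.
have mm : measurable_fun [set: R] (fun v => w v * (v * (F (t + v) - F (t - v)))).
  apply: (measurableT_comp (measurable_moment_weight F_nd mw) (g := fun v : R => (t, v))).
  exact: measurable_fun_pair.
have mc : measurable_fun [set: R] (fun v => (c%:E * (w v)%:E)%E).
  by apply: emeasurable_funM => //; exact/measurable_EFinP.
apply: (@le_trans _ _ (\int[mu]_v (c%:E * (w v)%:E +
    (w v * (v * (F (t + v) - F (t - v))))%:E))%E).
  apply: ge0_le_integral => //=.
  - by move=> v _; rewrite lee_fin.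
  - exact/measurable_EFinP.
  - by apply: emeasurable_funD => //; exact/measurable_EFinP.
  - move=> v _; rewrite -EFinM -EFinD lee_fin.
    have [v0|v0] := leP v 0; first by rewrite w0// mulr0 !mul0r addr0.
    rewrite mulrC [w v * (v * _)]mulrC -mulrDl ler_wpM2r//.
    have FF : 0 <= F (t + v) - F (t - v) by rewrite subr_ge0; apply: F_nd; lra.
    have [v1|v1] := leP v 1; first by apply: le_trans (hc _ v0 v1) _; nra.
    by apply: le_trans (hF _ (ltW v1)) _; nra.
rewrite ge0_integralD//=; last 3 first.
- by move=> v _; rewrite mule_ge0 ?lee_fin.
- by move=> v _; rewrite lee_fin; exact: moment_weight_ge0.
- exact/measurable_EFinP.
apply: leeD2r; rewrite ge0_integralZl_EFin//; last 2 first.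
- by move=> v _; rewrite lee_fin.
- exact/measurable_EFinP.
rewrite -[leRHS]mule1; apply: lee_wpmul2l; first by rewrite lee_fin.
exact: integral_half_kernel_le.
Qed.

Lemma left_increment_le (t c : R) : F (t + 1) - F (t - 1) <= c ->
  (left_increment F w t <= c%:E + moment_increment F w t)%E.
Proof.
move=> Fc.
have c0 : 0 <= c by apply: le_trans Fc; rewrite subr_ge0; apply: F_nd; lra.
apply: increment_integral_le => //.
- apply: (measurableT_comp (measurable_left_weight F_nd mw) (g := fun v : R => (t, v))).
  exact: measurable_fun_pair.
- by move=> v; exact: left_weight_ge0.
- move=> v v0 v1; apply: le_trans Fc; apply: lerB; apply: F_nd; lra.
- by move=> v v1; apply: lerB => //; apply: F_nd; lra.
Qed.

Lemma right_increment_le (t c : R) : F (t + 1) - F (t - 1) <= c ->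
  (right_increment F w t <= c%:E + moment_increment F w t)%E.
Proof.
move=> Fc.
have c0 : 0 <= c by apply: le_trans Fc; rewrite subr_ge0; apply: F_nd; lra.
apply: increment_integral_le => //.
- apply: (measurableT_comp (measurable_right_weight F_nd mw) (g := fun v : R => (t, v))).
  exact: measurable_fun_pair.
- by move=> v; exact: right_weight_ge0.
- move=> v v0 v1; apply: le_trans Fc; apply: lerB; apply: F_nd; lra.
- by move=> v v1; apply: lerB => //; apply: F_nd; lra.
Qed.

(** The integrand is [F t * sigma (t - u) - hp u + hn u]. By monotonicity [hp] vanishes for [u >= t]
    and [hn] for [u <= t], so [u = t - v] and [u = t + v] turn their integrals into the left and
    right increments. Finiteness of both makes the whole integrand absolutely integrable, hence the
    symmetric integrals converge. *)
Lemma convol_cvg (t : R) :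
  (left_increment F w t < +oo)%E -> (right_increment F w t < +oo)%E ->
  convol_partial sigma F t r @[r --> +oo] -->
  F t - fine (left_increment F w t) + fine (right_increment F w t).
Proof.
move=> Lfin Rfin.
pose hp (u : R) := sigma (t - u) * Num.max (F t - F u) 0.
pose hn (u : R) := sigma (t - u) * Num.max (F u - F t) 0.
have mst : measurable_fun [set: R] (fun u => sigma (t - u)).
  by apply: (measurableT_comp msigma); exact: measurable_funB.
have hp0 u : 0 <= hp u by rewrite mulr_ge0// le_max lexx orbT.
have hn0 u : 0 <= hn u by rewrite mulr_ge0// le_max lexx orbT.
have mhp : measurable_fun [set: R] hp.
  apply: measurable_funM => //; apply: measurable_maxr => //.
  exact: measurable_funB.
have mhn : measurable_fun [set: R] hn.
  apply: measurable_funM => //; apply: measurable_maxr => //.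
  exact: measurable_funB.
have Ihp : (\int[mu]_u (hp u)%:E)%E = left_increment F w t.
  rewrite -(@ge0_integral_reflect _ t (fun u => (hp u)%:E))//; last exact/measurable_EFinP.
  apply: eq_integral => v _; congr EFin; rewrite /hp /half_kernel subKr.
  case: ifPn => [v0|]; first congr (_ * _).
    by apply/max_idPl; rewrite subr_ge0; apply: F_nd; lra.
  rewrite -leNgt => v0; rewrite mul0r; apply/eqP; rewrite mulf_eq0; apply/orP; right.
  by apply/eqP/max_idPr; rewrite subr_le0; apply: F_nd; lra.
have Ihn : (\int[mu]_u (hn u)%:E)%E = right_increment F w t.
  rewrite -(@ge0_integral_shift _ t (fun u => (hn u)%:E))//; last exact/measurable_EFinP.
  apply: eq_integral => v _; congr EFin; rewrite /hn /half_kernel (addrC v t).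
  rewrite (_ : t - (t + v) = - v); last by ring.
  rewrite {1}/scaled_kernel mulrN rho_even.
  case: ifPn => [v0|]; first congr (_ * _).
    by apply/max_idPl; rewrite subr_ge0; apply: F_nd; lra.
  rewrite -leNgt => v0; rewrite mul0r; apply/eqP; rewrite mulf_eq0; apply/orP; right.
  by apply/eqP/max_idPr; rewrite subr_le0; apply: F_nd; lra.
have ihp : mu.-integrable setT (EFin \o hp).
  apply/integrableP; split; first exact/measurable_EFinP.
  under eq_integral => u _ do rewrite gee0_abs ?lee_fin//.
  by rewrite Ihp.
have ihn : mu.-integrable setT (EFin \o hn).
  apply/integrableP; split; first exact/measurable_EFinP.
  under eq_integral => u _ do rewrite gee0_abs ?lee_fin//.
  by rewrite Ihn.
have is_ : mu.-integrable setT (fun u => (sigma (t - u))%:E).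
  apply/integrableP; split; first exact/measurable_EFinP.
  under eq_integral => u _ do rewrite gee0_abs ?lee_fin//.
  by rewrite integral_scaled_kernel ltry.
have iFs := integrableZl measurableT (F t) is_.
have iD := integrableB measurableT iFs ihp.
have qE : (fun u => (sigma (t - u) * F u)%:E) =
    (((fun u => (F t)%:E * (sigma (t - u))%:E) \- (EFin \o hp)) \+ (EFin \o hn))%E.
  apply/funext => u /=; rewrite -EFinM -EFinB -EFinD; congr EFin.
  rewrite /hp /hn; have [h|h] := leP (F u) (F t).
    rewrite (_ : Num.max (F t - F u) 0 = F t - F u); last first.
      by apply/max_idPl; rewrite subr_ge0.
    rewrite (_ : Num.max (F u - F t) 0 = 0); last by apply/max_idPr; rewrite subr_le0.
    ring.
  rewrite (_ : Num.max (F t - F u) 0 = 0); last by apply/max_idPr; rewrite subr_le0 ltW.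
  rewrite (_ : Num.max (F u - F t) 0 = F u - F t); last first.
    by apply/max_idPl; rewrite subr_ge0 ltW.
  ring.
have iq : mu.-integrable setT (fun u => (sigma (t - u) * F u)%:E).
  by rewrite qE; exact: integrableD.
have := cvg_integral_symmetric_itv iq.
rewrite /convol_partial /Rintegral.
suff -> : (\int[mu]_u (sigma (t - u) * F u)%:E)%E =
   ((F t)%:E - left_increment F w t + right_increment F w t)%E.
  move: Lfin Rfin.
  have := left_increment_ge0 F_nd w_ge0 w0 t; have := right_increment_ge0 F_nd w_ge0 w0 t.
  by case: (left_increment F w t) => // l; case: (right_increment F w t).
rewrite qE integralD// integralB// integralZl//.
by rewrite integral_scaled_kernel mule1 Ihp Ihn.
Qed.

End convolution.

(** * Integrability on [[a, b]] and the two inequalities *)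

Theorem theorem1p6 (R : realType) (F : R -> R) (F_nd : nondecreasing F)
    (F_mid : forall t : R, F t = 2^-1 * (lim (F @ t^'+) + lim (F @ t^'-)))
    (rho : R -> R) (rho_cont : continuous rho)
    (rho_decay : exists m C : R,
      0 < m /\ forall t : R, `|rho t| <= C * (1 + t ^+ 2) `^ (- m - 1))
    (rho_int1 : \int[lebesgue_measure]_(t in [set: R]) rho t = 1)
    (rho_even : forall t : R, rho (- t) = rho t)
    (rho_ge0 : forall t : R, 0 <= rho t)
    (a b : R) (a_lt_b : a < b) (delta : R) (delta_gt0 : 0 < delta)
    (vanish_pinfty : forall t : R, t \in `[a, b] ->
      moment_kernel delta rho (t - s) * F s @[s --> +oo] --> (0 : R))
    (vanish_ninfty : forall t : R, t \in `[a, b] ->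
      moment_kernel delta rho (t - s) * F s @[s --> -oo] --> (0 : R))
    (conv_fin : forall t : R, t \in `[a, b] ->
      (convol_stieltjes (moment_kernel delta rho) F_nd t < +oo)%E)
    (conv_bounded : exists M : R, forall t : R, t \in `[a, b] ->
      (convol_stieltjes (moment_kernel delta rho) F_nd t <= M%:E)%E)
    (f : R -> R) (f_C1 : C1_itv a b f)
    (f_ge0 : forall t : R, t \in `[a, b] -> 0 <= f t)
    (f_nd : {in `[a, b] &, {homo f : x y / x <= y}})
    (T : R) (delta_le_T : delta <= T) :
  [/\ (* the quantities in the two inequalities are well defined *)
      (forall t : R, t \in `[a, b] ->
         cvg (convol_partial (scaled_kernel T rho) F t r @[r --> +oo])),
      lebesgue_measure.-integrable `[a, b]
        (fun t : R => (f t * (F t - convol (scaled_kernel T rho) F t))%:E),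
      (- ((T^-1 * delta^-1 * f b)%:E *
          convol_stieltjes (moment_kernel delta rho) F_nd b) <=
       \int[lebesgue_measure]_(t in `[a, b])
          (f t * (F t - convol (scaled_kernel T rho) F t))%:E)%E &
      (\int[lebesgue_measure]_(t in `[a, b])
          (f t * (F t - convol (scaled_kernel T rho) F t))%:E <=
       (T^-1 * delta^-1 * f a)%:E *
          convol_stieltjes (moment_kernel delta rho) F_nd a +
       (T^-1 * delta^-1)%:E *
          \int[lebesgue_measure]_(t in `[a, b])
            ((derive1 f t)%:E *
             convol_stieltjes (moment_kernel delta rho) F_nd t))%E].
Proof.
have T_gt0 : 0 < T := lt_le_trans delta_gt0 delta_le_T.
set k := T^-1 * delta^-1.
have k0 : 0 <= k by rewrite mulr_ge0// invr_ge0 ltW.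
set conv := convol_stieltjes (moment_kernel delta rho) F_nd.
pose w := half_kernel rho T.
have w_ge0 : forall v, 0 <= w v := half_kernel_ge0 rho_ge0 delta_gt0 delta_le_T.
have w0 : forall v, v <= 0 -> w v = 0 := half_kernel0 rho T.
have mw : measurable_fun [set: R] w by exact: measurable_half_kernel.
have conv0 t : (0 <= conv t)%E.
  rewrite /conv convol_stieltjesE; [|exact: measurable_moment_kernel
    |by move=> x; exact: moment_kernel_ge0].
  by apply: integral_ge0 => s _; rewrite lee_fin; exact: moment_kernel_ge0.
have mconv : measurable_fun [set: R] conv.
  apply: measurable_convol_stieltjes; first exact: measurable_moment_kernel.
  by move=> x; exact: moment_kernel_ge0.
have Zle t : (moment_increment F w t <= k%:E * conv t)%E by exact: moment_increment_le.
have Z0 t : (0 <= moment_increment F w t)%E by exact: moment_increment_ge0.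
have L0 t : (0 <= left_increment F w t)%E by exact: left_increment_ge0.
have R0 t : (0 <= right_increment F w t)%E by exact: right_increment_ge0.
have ab_a : a \in `[a, b] by rewrite in_itv/= lexx ltW.
have ab_b : b \in `[a, b] by rewrite in_itv/= lexx ltW.
have [M convM] := conv_bounded.
(* A bound for both increments uniform in [t]: [[t - 1, t + 1]] stays inside [[a - 1, b + 1]], and
   [k * M] bounds the moment. *)
pose K := (F (b + 1) - F (a - 1)) + k * M.
have increments_le t : t \in `[a, b] ->
    (left_increment F w t <= K%:E)%E /\ (right_increment F w t <= K%:E)%E.
  move=> tab; have := tab; rewrite in_itv/= => /andP[at_ tb].
  have Fc : F (t + 1) - F (t - 1) <= F (b + 1) - F (a - 1).
    by apply: lerB; apply/F_nd; lra.
  have ZK : ((F (b + 1) - F (a - 1))%:E + moment_increment F w t <= K%:E)%E.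
    rewrite /K [leRHS]EFinD; apply: leeD2l; apply: le_trans (Zle t) _.
    by rewrite (EFinM k M); apply: lee_wpmul2l; rewrite ?lee_fin ?convM.
  by split; apply: le_trans ZK; [exact: left_increment_le|exact: right_increment_le].
have convolE t : t \in `[a, b] ->
    convol_partial (scaled_kernel T rho) F t r @[r --> +oo] -->
    F t - fine (left_increment F w t) + fine (right_increment F w t).
  move=> tab; have [LK RK] := increments_le t tab.
  by apply: convol_cvg => //;
    [exact: le_lt_trans LK (ltry _)|exact: le_lt_trans RK (ltry _)].
pose phi := f \_ `[a, b].
pose d := derive1 f \_ `]a, b[.
have mphi : measurable_fun [set: R] phi by exact: measurable_C1_restrict.
have phi0 : forall t, 0 <= phi t by exact: C1_restrict_ge0.
have md : measurable_fun [set: R] d by exact: measurable_derive1_restrict.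
have d0 : forall t, 0 <= d t by exact: (derive1_restrict_ge0 f_C1 f_nd).
have mL : measurable_fun [set: R] (left_increment F w).
  apply: (@measurable_integral_EFin _ _ _ _ _ lebesgue_measure
    (fun t v : R => w v * (F t - F (t - v)))).
    exact: measurable_left_weight.
  by move=> t v; exact: left_weight_ge0.
have mR : measurable_fun [set: R] (right_increment F w).
  apply: (@measurable_integral_EFin _ _ _ _ _ lebesgue_measure
    (fun t v : R => w v * (F (t + v) - F t))).
    exact: measurable_right_weight.
  by move=> t v; exact: right_weight_ge0.
(* On [[a, b]] the product is at most [f b * K], and it vanishes elsewhere; this gives the
   finiteness that makes [IL - IR] meaningful. *)
have bounded_integrable (g : R -> \bar R) : measurable_fun [set: R] g ->
    (forall t, (0 <= g t)%E) -> (forall t, t \in `[a, b] -> (g t <= K%:E)%E) ->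
    lebesgue_measure.-integrable setT (fun t => (phi t)%:E * g t)%E.
  move=> mg g0 gK.
  have mphig : measurable_fun [set: R] (fun t => (phi t)%:E * g t)%E.
    by apply: emeasurable_funM => //; exact/measurable_EFinP.
  apply/integrableP; split => //.
  apply: (@le_lt_trans _ _
    (\int[lebesgue_measure]_(t in `[a, b]) (f b * K)%:E)%E); last first.
    rewrite integral_cst//= lebesgue_measure_itv/= lte_fin a_lt_b.
    by rewrite -EFinB -EFinM ltry.
  rewrite [leRHS]integral_mkcond; apply: ge0_le_integral => //=.
  - exact: measurableT_comp.
  - by apply/(measurable_restrictT (cst (f b * K)%:E)).
  - move=> t _; rewrite gee0_abs ?mule_ge0 ?lee_fin//.
    rewrite /phi !patchE; case: ifPn => [/set_mem/= tab|_]; last by rewrite mul0e.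
    rewrite EFinM lee_pmul ?lee_fin ?f_ge0//; last exact: gK.
    by apply: f_nd => //; move: tab; rewrite in_itv/= => /andP[].
have iL := bounded_integrable _ mL L0 (fun t tab => (increments_le t tab).1).
have iR := bounded_integrable _ mR R0 (fun t tab => (increments_le t tab).2).
pose IL := (\int[lebesgue_measure]_t ((phi t)%:E * left_increment F w t))%E.
pose IR := (\int[lebesgue_measure]_t ((phi t)%:E * right_increment F w t))%E.
have ILfin : IL \is a fin_num by exact: integrable_fin_num.
have IRfin : IR \is a fin_num by exact: integrable_fin_num.
have integrandE t : t \in `[a, b] ->
    ((phi t)%:E * left_increment F w t - (phi t)%:E * right_increment F w t)%E =
    (f t * (F t - convol (scaled_kernel T rho) F t))%:E.
  move=> tab; have [LK RK] := increments_le t tab.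
  rewrite /convol (cvg_lim _ (convolE t tab))// /phi patchE mem_set//=.
  have Lf : left_increment F w t \is a fin_num.
    by rewrite ge0_fin_numE// (le_lt_trans LK) ?ltry.
  have Rf : right_increment F w t \is a fin_num.
    by rewrite ge0_fin_numE// (le_lt_trans RK) ?ltry.
  rewrite -{1}(fineK Lf) -{1}(fineK Rf) -!EFinM -EFinB; congr EFin; ring.
have iLR := integrableB measurableT iL iR.
have -> : (\int[lebesgue_measure]_(t in `[a, b])
    (f t * (F t - convol (scaled_kernel T rho) F t))%:E = IL - IR)%E.
  rewrite [LHS]integral_mkcond -(integralB measurableT iL iR).
  apply: eq_integral => t _; rewrite patchE; case: ifPn => [/set_mem/= tab|].
    by rewrite -integrandE.
  move=> /negP; rewrite inE => tab.
  by rewrite /phi patchE memNset//= !mul0e sube0.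
split.
- by move=> t tab; apply/cvg_ex; eexists; exact: convolE.
- apply: (@eq_integrable _ _ _ lebesgue_measure `[a, b] (measurable_itv _)
    ((fun t => (phi t)%:E * left_increment F w t) \-
     (fun t => (phi t)%:E * right_increment F w t))%E).
    by move=> t /set_mem/= tab; exact: integrandE.
  exact: (integrableS measurableT).
- have lb := right_increment_ub F_nd mw w_ge0 w0 mphi phi0 (f_ge0 _ ab_b)
    (fun t v v0 => C1_restrict_lb a_lt_b f_ge0 f_nd t v0).
  have : (IR <= IL + (k * f b)%:E * conv b)%E.
    apply: le_trans lb _; apply: leeD2l; rewrite [k * _]mulrC EFinM -muleA.
    by apply: lee_wpmul2l; rewrite ?lee_fin ?f_ge0.
  (* With every term finite, [IR <= IL + X] rearranges to [- X <= IL - IR] by real arithmetic. *)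
  have Xfin : ((k * f b)%:E * conv b)%E \is a fin_num.
    by rewrite fin_numM// ge0_fin_numE// conv_fin.
  rewrite -(fineK ILfin) -(fineK IRfin) -(fineK Xfin) -EFinD -EFinN -EFinB !lee_fin.
  lra.
- have ub := left_increment_ub F_nd mw w_ge0 w0 mphi phi0 md d0 (f_ge0 _ ab_a)
    (fun t v v0 => C1_restrict_ub a_lt_b f_C1 f_ge0 f_nd t v0).
  rewrite leeBlDl//; apply: le_trans ub _; apply: leeD2l; apply: leeD.
    rewrite [k * _]mulrC EFinM -muleA.
    by apply: lee_wpmul2l; rewrite ?lee_fin ?f_ge0.
  have mdc : measurable_fun [set: R] (fun u => (d u)%:E * conv u)%E.
    by apply: emeasurable_funM => //; exact/measurable_EFinP.
  have -> : (\int[lebesgue_measure]_(t in `[a, b]) ((derive1 f t)%:E * conv t) =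
      \int[lebesgue_measure]_t ((d t)%:E * conv t))%E.
    (* The endpoints, where [derive1 f] is unconstrained, form a null set; on the open interval [d]
       and [derive1 f] agree. *)
    rewrite integral_itv_bndoo.
      rewrite integral_mkcond; apply: eq_integral => t _.
      by rewrite /d !patchE; case: ifP => // _; rewrite mul0e.
    apply: (@eq_measurable_fun _ _ _ _ _ (fun u => (d u)%:E * conv u)%E).
      by move=> u uab; rewrite /d patchE uab.
    exact: measurable_funTS.
  rewrite -ge0_integralZl_EFin//; last by move=> u _; rewrite mule_ge0 ?lee_fin.
  apply: ge0_le_integral => //=.
  + by move=> u _; rewrite mule_ge0 ?lee_fin.
  + apply: emeasurable_funM; first exact/measurable_EFinP.
    apply: (@measurable_integral_EFin _ _ _ _ _ lebesgue_measure
      (fun t v : R => w v * (v * (F (t + v) - F (t - v))))).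
      exact: measurable_moment_weight.
    by move=> t v; exact: moment_weight_ge0.
  + exact: emeasurable_funM.
  + by move=> u _; rewrite muleCA; apply: lee_wpmul2l; rewrite ?lee_fin.
Qed.
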